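(* Timeline Partial Dominating Set can be solved in $\big((k+1)(\ell+2)\big)^{2\cdot \mathrm{vimw}}\cdot (n+T)^{\mathcal{O}(1)}$ time, where $n=|V|$ and $\mathrm{vimw}$ is the vertex-interval-membership-width of the input temporal graph.
   Context: A temporal graph $\mathcal{G}=(G_1,\dots,G_T)$ is a finite sequence of simple undirected graphs (snapshots) on a common finite vertex set $V$, $n=|V|$. A temporal vertex is a pair $(v,i)$, $v\in V$, $i\in[T]$. An activity interval is a triple $(v,a,b)$ with $v\in V$, $1\le a\le b\le T$; its length is $b-a$. A $k$-activity $\ell$-timeline is a set of activity intervals with at most $k$ intervals per vertex, each of length at most $\ell$. A vertex $v$ is active at time $i$ if some $(v,a,b)$ in the timeline has $a\le i\le b$; the timeline dominates $(v,i)$ if $v\in N_{G_i}[u]$ for some $u$ active at time $i$. Timeline Partial Dominating Set: given $\mathcal{G}$ and integers $k\ge1,\ell\ge0,t\ge0$, decide whether some $k$-activity $\ell$-timeline dominates at least $t$ temporal vertices. The vertex-interval-membership sequence is $(F_i)_{i\in[T]}$ with $F_i=\{v\in V:\exists p\le i\le q \text{ with } \deg_{G_p}(v)\ge1,\ \deg_{G_q}(v)\ge1\}$; $\mathrm{vimw}(\mathcal{G})=\max_i|F_i|$. *)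

(* Defs.v *)
From mathcomp Require Import all_boot.

Set Implicit Arguments.
Unset Strict Implicit.
Unset Printing Implicit Defensive.

(* Snapshots G_1, ..., G_T are indexed from 0, by 'I_T. *)
Record tgraph (V : finType) (T : nat) := TGraph {
  adj : 'I_T -> rel V;
  adj_sym : forall i, symmetric (adj i);
  adj_irr : forall i, irreflexive (adj i)
}.

Section TemporalGraph.
Variables (V : finType) (T : nat) (G : tgraph V T).

Definition nbhd (i : 'I_T) (v : V) : {set V} := [set u | adj G i v u].
Definition closed_nbhd (i : 'I_T) (v : V) : {set V} := v |: nbhd i v.
Definition deg (i : 'I_T) (v : V) : nat := #|nbhd i v|.

Definition vim_set (i : 'I_T) : {set V} :=
  [set v | [exists p : 'I_T, exists q : 'I_T,
     [&& p <= i <= q, 1 <= deg p v & 1 <= deg q v]]].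
Definition vimw : nat := \max_(i < T) #|vim_set i|.

(* A triple (v, a, b); the condition a <= b is part of [is_timeline]. *)
Definition activity := (V * 'I_T * 'I_T)%type.
Definition vertex_of (I : activity) : V := I.1.1.
Definition first_of (I : activity) : 'I_T := I.1.2.
Definition last_of (I : activity) : 'I_T := I.2.

Definition is_timeline (k l : nat) (A : {set activity}) : bool :=
  [forall I in A, (first_of I <= last_of I) && (last_of I - first_of I <= l)]
  && [forall v : V, #|[set I in A | vertex_of I == v]| <= k].

Definition active (A : {set activity}) (v : V) (i : 'I_T) : bool :=
  [exists I in A, (vertex_of I == v) && (first_of I <= i <= last_of I)].

Definition dominated (A : {set activity}) : {set V * 'I_T} :=
  [set x | [exists u, active A u x.2 && (x.1 \in closed_nbhd x.2 u)]].

Definition timeline_partial_dominating_set (k l t : nat) : bool :=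
  [exists A : {set activity}, is_timeline k l A && (t <= #|dominated A|)].

End TemporalGraph.

(* Random access machine with uniform cost, in the version customary in        *)
(* (parameterized) complexity (Papadimitriou; Flum and Grohe): registers hold  *)
(* natural numbers, the arithmetic instructions are addition, cut-off          *)
(* subtraction and halving, and each instruction takes one unit of time.       *)
(* There is no multiplication, as it would make uniform cost unreasonable.     *)
(* The input is a read-only array, separate from the registers.                *)
Inductive instr :=
  | Const of nat & nat          (* R[d] := c *)
  | Move of nat & nat           (* R[d] := R[a] *)
  | Read of nat & nat           (* R[d] := input[R[a]], 0 if out of range *)
  | Iload of nat & nat          (* R[d] := R[R[a]] *)
  | Istore of nat & nat         (* R[R[d]] := R[a] *)
  | Iadd of nat & nat & nat     (* R[d] := R[a] + R[b] *)
  | Isub of nat & nat & nat     (* R[d] := R[a] - R[b] *)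
  | Ihalf of nat & nat          (* R[d] := floor (R[a] / 2) *)
  | Jump of nat                 (* goto m *)
  | Jzero of nat & nat          (* if R[a] = 0 goto m *)
  | Halt.

Definition program := seq instr.

Record config := Config { pc : nat; reg : nat -> nat }.

Definition set_reg (s : config) (d x : nat) : config :=
  Config (pc s).+1 (fun j => if j == d then x else reg s j).

Definition step (P : program) (input : seq nat) (s : config) : config :=
  let R := reg s in
  match nth Halt P (pc s) with
  | Const d c => set_reg s d c
  | Move d a => set_reg s d (R a)
  | Read d a => set_reg s d (nth 0 input (R a))
  | Iload d a => set_reg s d (R (R a))
  | Istore d a => set_reg s (R d) (R a)
  | Iadd d a b => set_reg s d (R a + R b)
  | Isub d a b => set_reg s d (R a - R b)
  | Ihalf d a => set_reg s d (R a)./2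
  | Jump m => Config m R
  | Jzero a m => Config (if R a == 0 then m else (pc s).+1) R
  | Halt => s
  end.

Definition halted (P : program) (s : config) : bool :=
  if nth Halt P (pc s) is Halt then true else false.

Definition run (P : program) (input : seq nat) (m : nat) : config :=
  iter m (step P input) (Config 0 (fun=> 0)).

(* The answer is left in register 0, as 1 (yes) or 0 (no). *)
Definition decides_within (P : program) (input : seq nat) (answer : bool)
    (time : nat) : Prop :=
  exists m, [/\ m <= time, halted P (run P input m)
              & reg (run P input m) 0 = answer].

(* The vertex set is numbered 0, ..., n-1; the five numbers n, T, k, l, t are  *)
(* followed by the adjacency matrices of the snapshots in row-major order.     *)
Definition encode (n T : nat) (G : tgraph 'I_n T) (k l t : nat) : seq nat :=
  [:: n; T; k; l; t] ++
  flatten [seq flatten [seq [seq nat_of_bool (adj G i u v) | v <- enum 'I_n]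
                       | u <- enum 'I_n]
          | i <- enum 'I_T].

(* Main.v *)
Require Import Defs.
From mathcomp Require Import all_boot zify.

(** A timeline may be assumed to consist of intervals of full length, so each
    vertex only chooses at most [k] starting times, and [k] and [l] may be
    truncated at [T].  Sweeping over time, a vertex in the current bag [F_i] is
    in one of [(k+1)(l+2)] states: the number of intervals used so far and the
    remaining activity time.  Outside its bags a vertex is isolated and matters
    only to itself, and the number of time steps it can dominate there has a
    closed form in terms of its state when it enters, respectively leaves, the
    bags.  A table over the states of the successive bags, filled by trying all
    pairs of consecutive states, therefore computes the optimum.

    The random access program is obtained from a small expression language with
    bounded loops.  All loops but one are bounded by [2n + T + 2], so the running
    time is polynomial except for the loop over the previous states, which is
    executed once for each entry of the table. *)

Set Implicit Arguments.
Unset Strict Implicit.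
Unset Printing Implicit Defensive.

(** * Expressions and their compilation *)

(** Two obstacles shape the proof. First, a state does not record when a vertex used its intervals
    outside its bags. The entry condition only bounds the activity that the used intervals can pay
    for; the gain before the bags is credited at once on entry, and that after them in advance on
    exit. The two translations are therefore inequalities: the path of a schedule gains at least
    what the schedule dominates, and a path is turned into a schedule worth at least its gain by
    packing the intervals of unknown position contiguously against the bags. Second, codes of states
    are exponentially large, while multiplication is missing and loops must stay polynomially short.
    So every product has one small factor and digits are extracted by divisions with small
    quotients. This is where truncation at [T] pays off: every radix is at most [T + 2] and so
    within the loop bound. As that bound is one fixed expression depending only on the input,
    polynomial cost becomes a syntactic property, whatever the size of the values. *)

Inductive expr :=
  | Var of nat
  | Cst of nat
  | Add of expr & expr
  | Sub of expr & expr
  | Inp of expr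
  | Tab of expr
  | Ite of expr & expr & expr
  | Fold of expr & expr & expr
  | Call of expr & expr & expr & expr & expr.

Section Semantics.
Variable input : seq nat.

(** The body of a [Call] sees only its four arguments, so a loop directly inside it always has its
    accumulator in [Var 4] and its counter in [Var 5]. [M] is the table filled so far. *)
Fixpoint eval (M : nat -> nat) (env : seq nat) (e : expr) : nat :=
  match e with
  | Var i => nth 0 env i
  | Cst c => c
  | Add a b => eval M env a + eval M env b
  | Sub a b => eval M env a - eval M env b
  | Inp a => nth 0 input (eval M env a)
  | Tab a => M (eval M env a)
  | Ite a b c => if eval M env a == 0 then eval M env c else eval M env b
  | Fold l i b =>
      iteri (eval M env l) (fun x acc => eval M (env ++ [:: acc; x]) b)
        (eval M env i)
  | Call f a b c d =>
      eval M [:: eval M env a; eval M env b; eval M env c; eval M env d] f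
  end.

Definition fold_acc M env i b x : nat :=
  iteri x (fun x acc => eval M (env ++ [:: acc; x]) b) (eval M env i).

(** The exact number of machine steps. A loop pays 6 per round for the test and the updates, and 4
    for its initialisation, last test and final move; the first branch of [Ite] pays one more for
    jumping over the second. *)
Fixpoint cost (M : nat -> nat) (env : seq nat) (e : expr) : nat :=
  match e with
  | Var _ | Cst _ => 1
  | Add a b | Sub a b => cost M env a + cost M env b + 1
  | Inp a => cost M env a + 1
  | Tab a => cost M env a + 3
  | Ite a b c =>
      cost M env a +
      if eval M env a == 0 then cost M env c + 1 else cost M env b + 2
  | Fold l i b =>
      cost M env l + cost M env i +
      \sum_(x < eval M env l)
         (cost M (env ++ [:: fold_acc M env i b x; val x]) b + 6) + 4
  | Call f a b c d =>
      cost M env a + cost M env b + cost M env c + cost M env d +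
      cost M [:: eval M env a; eval M env b; eval M env c; eval M env d] f + 1
  end.

End Semantics.

Fixpoint code_size (e : expr) : nat :=
  match e with
  | Var _ | Cst _ => 1
  | Add a b | Sub a b => code_size a + code_size b + 1
  | Inp a => code_size a + 1
  | Tab a => code_size a + 3
  | Ite a b c => code_size a + code_size b + code_size c + 2
  | Fold l i b => code_size l + code_size i + code_size b + 8
  | Call f a b c d =>
      code_size a + code_size b + code_size c + code_size d + code_size f + 1
  end.

Fixpoint scratch (e : expr) : nat :=
  match e with
  | Var _ | Cst _ => 1
  | Add a b | Sub a b => scratch a + scratch b + 2
  | Inp a => scratch a + 1
  | Tab a => scratch a + 2
  | Ite a b c => scratch a + scratch b + scratch c + 1
  | Fold l i b => scratch l + scratch i + scratch b + 4
  | Call f a b c d =>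
      scratch a + scratch b + scratch c + scratch d + scratch f + 5
  end.

(* [ctx] lists the registers holding the variables, [f] is the first free      *)
(* register, which receives the value; the table starts at register [K].       *)
Fixpoint compile (K p : nat) (ctx : seq nat) (f : nat) (e : expr) : program :=
  match e with
  | Var i =>
      if i < size ctx then [:: Move f (nth 0 ctx i)] else [:: Const f 0]
  | Cst c => [:: Const f c]
  | Add a b =>
      compile K p ctx f a ++
      compile K (p + code_size a) ctx f.+1 b ++ [:: Iadd f f f.+1]
  | Sub a b =>
      compile K p ctx f a ++
      compile K (p + code_size a) ctx f.+1 b ++ [:: Isub f f f.+1]
  | Inp a => compile K p ctx f a ++ [:: Read f f]
  | Tab a =>
      compile K p ctx f a ++ [:: Const f.+1 K; Iadd f f f.+1; Iload f f]
  | Ite a b c =>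
      let p1 := p + code_size a + 1 in
      let p2 := p1 + code_size b + 1 in
      compile K p ctx f a ++ [:: Jzero f p2] ++
      compile K p1 ctx f b ++ [:: Jump (p2 + code_size c)] ++
      compile K p2 ctx f c
  | Fold l i b =>
      let p1 := p + code_size l in
      let p2 := p1 + code_size i + 1 in
      compile K p ctx f l ++ compile K p1 ctx f.+1 i ++
      [:: Const f.+2 0; Isub f.+3 f f.+2; Jzero f.+3 (p2 + code_size b + 6)] ++
      compile K p2.+2 (ctx ++ [:: f.+1; f.+2]) f.+3 b ++
      [:: Move f.+1 f.+3; Const f.+3 1; Iadd f.+2 f.+2 f.+3; Jump p2;
          Move f f.+1]
  | Call g a b c d =>
      let p1 := p + code_size a in
      let p2 := p1 + code_size b in
      let p3 := p2 + code_size c in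
      let p4 := p3 + code_size d in
      compile K p ctx f a ++ compile K p1 ctx f.+1 b ++
      compile K p2 ctx f.+2 c ++ compile K p3 ctx f.+3 d ++
      compile K p4 [:: f; f.+1; f.+2; f.+3] f.+4 g ++ [:: Move f f.+4]
  end.

Lemma size_compile K p ctx f e : size (compile K p ctx f e) = code_size e.
Proof.
elim: e p ctx f => /=.
- by move=> i p ctx f; case: ifP.
- by [].
- by move=> a Ha b Hb p ctx f; rewrite !size_cat Ha Hb /=; lia.
- by move=> a Ha b Hb p ctx f; rewrite !size_cat Ha Hb /=; lia.
- by move=> a Ha p ctx f; rewrite !size_cat Ha.
- by move=> a Ha p ctx f; rewrite !size_cat Ha.
- move=> a Ha b Hb c Hc p ctx f.
  by rewrite size_cat Ha /= size_cat Hb /= Hc; lia.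
- move=> a Ha b Hb c Hc p ctx f; rewrite size_cat Ha size_cat Hb /=.
  by rewrite size_cat Hc /=; lia.
- move=> g Hg a Ha b Hb c Hc d Hd p ctx f.
  by rewrite !size_cat Ha Hb Hc Hd Hg /=; lia.
Qed.

(** * Correctness of the compiler *)

Section Machine.
Variables (P : program) (input : seq nat).

Definition code_at (p : nat) (c : program) : Prop :=
  forall i, i < size c -> nth Halt P (p + i) = nth Halt c i.

Lemma code_at_cat p c1 c2 :
  code_at p (c1 ++ c2) -> code_at p c1 /\ code_at (p + size c1) c2.
Proof.
move=> H; split=> i Hi.
  by rewrite H ?size_cat ?nth_cat ?Hi //; lia.
rewrite -addnA H ?size_cat ?nth_cat; last by lia.
by rewrite ltnNge leq_addr /= addKn.
Qed.

Lemma code_at_cons p i c :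
  code_at p (i :: c) -> nth Halt P p = i /\ code_at p.+1 c.
Proof.
move=> H; split; first by have := H 0 isT; rewrite addn0.
by move=> j Hj; have := H j.+1; rewrite addnS addSn; apply.
Qed.

Definition reach m p R p' R' :=
  iter m (step P input) (Config p R) = Config p' R'.

Lemma reach_trans m1 m2 p1 R1 p2 R2 p3 R3 :
  reach m1 p1 R1 p2 R2 -> reach m2 p2 R2 p3 R3 -> reach (m1 + m2) p1 R1 p3 R3.
Proof. by rewrite /reach addnC iterD => ->. Qed.

Definition upd (R : nat -> nat) d x := fun j => if j == d then x else R j.

Lemma upd_same R d x : upd R d x d = x.
Proof. by rewrite /upd eqxx. Qed.

Lemma upd_other R d x j : j != d -> upd R d x j = R j.
Proof. by rewrite /upd => /negbTE ->. Qed.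

Definition effect (i : instr) (R : nat -> nat) : nat -> nat :=
  match i with
  | Const d c => upd R d c
  | Move d a => upd R d (R a)
  | Read d a => upd R d (nth 0 input (R a))
  | Iload d a => upd R d (R (R a))
  | Istore d a => upd R (R d) (R a)
  | Iadd d a b => upd R d (R a + R b)
  | Isub d a b => upd R d (R a - R b)
  | Ihalf d a => upd R d (R a)./2
  | _ => R
  end.

Definition target (i : instr) (p : nat) (R : nat -> nat) : nat :=
  match i with
  | Jump m => m
  | Jzero a m => if R a == 0 then m else p.+1
  | Halt => p
  | _ => p.+1
  end.

Lemma reach_step p R i : nth Halt P p = i -> reach 1 p R (target i p R) (effect i R).
Proof. by rewrite /reach /= /step /= => ->; case: i. Qed.

Lemma reach_loop (inv : nat -> (nat -> nat) -> Prop) (c : nat -> nat) p B R :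
  inv 0 R ->
  (forall x R', x < B -> inv x R' ->
     exists R'', reach (c x) p R' p R'' /\ inv x.+1 R'') ->
  exists R', reach (\sum_(x < B) c x) p R p R' /\ inv B R'.
Proof.
move=> H0 Hs; suff: forall x, x <= B ->
    exists R', reach (\sum_(y < x) c y) p R p R' /\ inv x R' by apply.
elim=> [_|x IH Hx]; first by exists R; rewrite big_ord0.
have [R1 [r1 i1]] := IH (ltnW Hx).
have [R2 [r2 i2]] := Hs x R1 Hx i1.
by exists R2; split=> //; rewrite big_ord_recr /=; apply: reach_trans r1 r2.
Qed.

(** Registers below [f] hold live values and those from [K] on hold the table; only the ones in
    between may change. *)
Definition frame K f (R R' : nat -> nat) :=
  forall r, (r < f) || (K <= r) -> R' r = R r.

Lemma frame_trans K f f' R1 R2 R3 :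
  f <= f' -> frame K f R1 R2 -> frame K f' R2 R3 -> frame K f R1 R3.
Proof. by move=> Hf H1 H2 r Hr; rewrite H2 ?H1 //; lia. Qed.

Lemma frame_refl K f R : frame K f R R.
Proof. by []. Qed.

Lemma frame_upd K f d x R : f <= d < K -> frame K f R (upd R d x).
Proof. by move=> Hd r Hr; rewrite upd_other //; lia. Qed.

Lemma frame_map K f R R' ctx :
  all (fun r => r < f) ctx -> frame K f R R' -> map R' ctx = map R ctx.
Proof.
by move=> /allP H HR; apply/eq_in_map => r /H Hr; rewrite HR ?Hr.
Qed.

Lemma all_ltn_trans f f' ctx :
  f <= f' -> all (fun r => r < f) ctx -> all (fun r => r < f') ctx.
Proof. by move=> Hf; apply: sub_all => r /leq_trans; apply. Qed.

Definition compiles_to K (e : expr) : Prop :=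
  forall p ctx f R M env,
    code_at p (compile K p ctx f e) -> all (fun r => r < f) ctx ->
    f + scratch e <= K -> (forall m, R (K + m) = M m) -> map R ctx = env ->
    exists R', [/\ reach (cost input M env e) p R (p + code_size e) R',
                   R' f = eval input M env e & frame K f R R'].

Lemma compile_binary K a b (op : nat -> nat -> nat) mk
    p ctx f R M env :
  compiles_to K a -> compiles_to K b ->
  (forall R, effect mk R = upd R f (op (R f) (R f.+1))) ->
  (forall p R, target mk p R = p.+1) ->
  code_at p (compile K p ctx f a ++
             compile K (p + code_size a) ctx f.+1 b ++ [:: mk]) ->
  all (fun r => r < f) ctx -> f + (scratch a + scratch b + 2) <= K ->
  (forall m, R (K + m) = M m) -> map R ctx = env ->
  exists R', [/\ reach (cost input M env a + cost input M env b + 1) p R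
                   (p + (code_size a + code_size b + 1)) R',
                 R' f = op (eval input M env a) (eval input M env b)
               & frame K f R R'].
Proof.
move=> Ha Hb Heff Htgt /code_at_cat[Ca]; rewrite size_compile.
move=> /code_at_cat[Cb]; rewrite size_compile => /code_at_cons[Cc _] Hctx HK HM He.
have [||R1 [r1 v1 f1]] := Ha _ _ _ _ _ _ Ca _ _ HM He => //; first by lia.
have [||||R2 [r2 v2 f2]] := Hb _ _ _ R1 M env Cb.
- exact: all_ltn_trans Hctx.
- by lia.
- by move=> m; rewrite f1 ?HM //; lia.
- by rewrite (frame_map Hctx f1).
have r3 := reach_step R2 Cc; rewrite Heff Htgt in r3.
exists (upd R2 f (op (R2 f) (R2 f.+1))); split.
- have -> : p + (code_size a + code_size b + 1) =
            (p + code_size a + code_size b).+1 by lia.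
  by apply: reach_trans r3; apply: reach_trans r2.
- by rewrite upd_same v2 f2 ?v1 //; lia.
- apply: (frame_trans (leqnn f) (frame_trans (leqnSn f) f1 f2)).
  by apply: frame_upd; lia.
Qed.

(** Subexpressions are compiled with a free register above all results that are still needed, so
    [frame] keeps these alive; expressions only read the table, so [M] stays fixed. *)
Lemma compileP K e : compiles_to K e.
Proof.
elim: e => [i|c|a Ha b Hb|a Ha b Hb|a Ha|a Ha|a Ha b Hb c Hc|l Hl i Hi b Hb
           |g Hg a Ha b Hb c Hc d Hd] p ctx f R M env /=.
- case: ifP => Hsz /code_at_cons[Cc _] Hctx HK HM He.
    exists (effect (Move f (nth 0 ctx i)) R); split.
    + by have := reach_step R Cc; rewrite /= addn1.
    + by rewrite /= upd_same -He (nth_map 0).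
    + by apply: frame_upd; lia.
  exists (effect (Const f 0) R); split.
  + by have := reach_step R Cc; rewrite /= addn1.
  + by rewrite /= upd_same -He nth_default // size_map leqNgt Hsz.
  + by apply: frame_upd; lia.
- move=> /code_at_cons[Cc _] Hctx HK HM He.
  exists (effect (Const f c) R); split.
  + by have := reach_step R Cc; rewrite /= addn1.
  + by rewrite /= upd_same.
  + by apply: frame_upd; lia.
- exact: compile_binary.
- exact: compile_binary.
- move=> /code_at_cat[Ca]; rewrite size_compile => /code_at_cons[Cc _] Hctx HK HM He.
  have [||R1 [r1 v1 f1]] := Ha _ _ _ _ _ _ Ca _ _ HM He => //; first by lia.
  exists (effect (Read f f) R1); split.
  + have -> : p + (code_size a + 1) = (p + code_size a).+1 by lia.
    exact: reach_trans r1 (reach_step R1 Cc).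
  + by rewrite /= upd_same v1.
  + by apply: (frame_trans (leqnn f) f1); apply: frame_upd; lia.
- move=> /code_at_cat[Ca]; rewrite size_compile => /code_at_cons[C1].
  move=> /code_at_cons[C2] /code_at_cons[C3 _] Hctx HK HM He.
  have [||R1 [r1 v1 f1]] := Ha _ _ _ _ _ _ Ca _ _ HM He => //; first by lia.
  have r2 := reach_step R1 C1; set R2 := effect _ _ in r2.
  have r3 := reach_step R2 C2; set R3 := effect _ _ in r3.
  have r4 := reach_step R3 C3; set R4 := effect _ _ in r4.
  have v3 : R3 f = K + eval input M env a.
    rewrite /R3 /= upd_same /R2 /= upd_same upd_other ?v1 1?addnC //; lia.
  have f3 : frame K f R R3.
    apply: (frame_trans (leqnn f) f1); apply: (@frame_trans K f f _ R2) => //;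
      by apply: frame_upd; lia.
  exists R4; split.
  + have -> : p + (code_size a + 3) = (p + code_size a).+3 by lia.
    apply: (reach_trans r1); rewrite -[3]/(1 + (1 + 1)).
    by apply: (reach_trans r2); apply: (reach_trans r3).
  + by rewrite /R4 /= upd_same v3 f3 ?HM //; lia.
  + by apply: (frame_trans (leqnn f) f3); apply: frame_upd; lia.
- move=> /code_at_cat[Ca]; rewrite size_compile => /code_at_cons[C1].
  move=> /code_at_cat[Cb]; rewrite size_compile => /code_at_cons[C2 Cc] Hctx HK HM He.
  have [||R1 [r1 v1 f1]] := Ha _ _ _ _ _ _ Ca _ _ HM He => //; first by lia.
  have r2 := reach_step R1 C1; rewrite /= v1 in r2.
  have HM1 m : R1 (K + m) = M m by rewrite f1 ?HM //; lia.
  have He1 : map R1 ctx = env by rewrite (frame_map Hctx f1).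
  case: eqP r2 => _ r2.
    have [|||||R3 [r3 v3 f3]] := Hc (p + code_size a + 1 + code_size b + 1) ctx f R1 M env.
    * by move: Cc; congr code_at; lia.
    * by [].
    * by lia.
    * by [].
    * by [].
    exists R3; split=> //; last exact: frame_trans f1 f3.
    have -> : p + (code_size a + code_size b + code_size c + 2) =
              p + code_size a + 1 + code_size b + 1 + code_size c by lia.
    by rewrite (addnC _ 1); apply: reach_trans r1 _; apply: reach_trans r2 r3.
  have [|||||R3 [r3 v3 f3]] := Hb (p + code_size a + 1) ctx f R1 M env.
  * by move: Cb; congr code_at; lia.
  * by [].
  * by lia.
  * by [].
  * by [].
  have r4 := reach_step R3 C2.
  exists R3; split=> //; last exact: frame_trans f1 f3.
  have -> : p + (code_size a + code_size b + code_size c + 2) =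
            p + code_size a + 1 + code_size b + 1 + code_size c by lia.
  have -> : cost input M env b + 2 = 1 + (cost input M env b + 1) by lia.
  apply: (reach_trans r1); apply: (reach_trans r2).
  move: r3 r4; rewrite /= !addn1 !addSn => r3 r4.
  by rewrite -addn1; apply: reach_trans r3 r4.
- set lb := code_size b.
  move=> /code_at_cat[Cl]; rewrite size_compile => /code_at_cat[Ci].
  rewrite size_compile => /code_at_cons[C1] /code_at_cons[C2] /code_at_cons[C3].
  move=> /code_at_cat[Cb]; rewrite size_compile => /code_at_cons[C4].
  move=> /code_at_cons[C5] /code_at_cons[C6] /code_at_cons[C7] /code_at_cons[C8 _].
  move=> Hctx HK HM He.
  have [||R1 [r1 v1 f1]] := Hl _ _ _ _ _ _ Cl _ _ HM He => //; first by lia.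
  have [||||R2 [r2 v2 f2]] := Hi _ _ _ R1 M env Ci.
  + exact: all_ltn_trans Hctx.
  + by lia.
  + by move=> m; rewrite f1 ?HM //; lia.
  + by rewrite (frame_map Hctx f1).
  have r3 := reach_step R2 C1; set R3 := effect _ _ in r3; rewrite /= in r3.
  set q := (p + code_size l + code_size i).+1 in r3 C2.
  set B := eval input M env l.
  (* At the loop head [f] holds the number of rounds, [f.+1] the accumulator and [f.+2] the counter;
     [f.+3] serves the test and then the body. *)
  pose inv x R := [/\ frame K f R1 R, R f.+2 = x, R f = B
                     & R f.+1 = fold_acc input M env i b x].
  have inv_start : inv 0 R3.
    split.
    + by move=> r Hr; rewrite /R3 /= upd_other ?f2 //; lia.
    + by rewrite /R3 /= upd_same.
    + rewrite /R3 /= upd_other ?f2 ?v1 //; lia.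
    + rewrite /R3 /= upd_other ?v2 //; lia.
  have [x S0 Hx [i1 i2 i3 i4]|R4 [r4 [i1 i2 i3 i4]]] := @reach_loop inv (fun x =>
      cost input M (env ++ [:: fold_acc input M env i b x; x]) b + 6) q B R3 inv_start.
  + have s1 := reach_step S0 C2; set S1 := effect _ _ in s1; rewrite /= in s1.
    have v5 : S1 f.+3 = B - x by rewrite /S1 /= upd_same i2 i3.
    have s2 := reach_step S1 C3; rewrite /= v5 ifF in s2; last by lia.
    have g1 : frame K f.+3 S0 S1 by apply: frame_upd; lia.
    have Hctx' : all (fun r => r < f.+3) (ctx ++ [:: f.+1; f.+2]).
      by rewrite all_cat /= !ltnS leqnn leqnSn (@all_ltn_trans f) //; lia.
    have [|||||S2 [s3 w3 g3]] := Hb q.+2 (ctx ++ [:: f.+1; f.+2]) f.+3 S1 M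
        (env ++ [:: fold_acc input M env i b x; x]).
    * have -> : q.+2 = (p + code_size l + code_size i + 1).+2 by rewrite /q; lia.
      by move: Cb; congr code_at; lia.
    * by [].
    * by lia.
    * by move=> m; rewrite g1 ?i1 ?f1 ?HM //; lia.
    * rewrite (frame_map Hctx' g1) map_cat /= i2 i4 (frame_map Hctx i1).
      by rewrite (frame_map Hctx f1) He.
    have s4 := reach_step S2 C4; set S3 := effect _ _ in s4; rewrite /= in s4.
    have s5 := reach_step S3 C5; set S4 := effect _ _ in s5; rewrite /= in s5.
    have s6 := reach_step S4 C6; set S5 := effect _ _ in s6; rewrite /= in s6.
    have s7 := reach_step S5 C7; rewrite /= in s7.
    have g2 : frame K f.+3 S0 S2 by exact: frame_trans g1 g3.
    exists S5; split.
      have -> : cost input M (env ++ [:: fold_acc input M env i b x; x]) b + 6 =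
         1 + (1 + (cost input M (env ++ [:: fold_acc input M env i b x; x]) b +
         (1 + (1 + (1 + 1))))) by lia.
      apply: (reach_trans s1); apply: (reach_trans s2); apply: (reach_trans s3).
      apply: (reach_trans s4); apply: (reach_trans s5); apply: (reach_trans s6).
      by move: s7; rewrite addn1.
    have e1 : S4 f.+2 = x.
      by rewrite /S4 /= upd_other /S3 /= ?upd_other ?g2 ?i2 //; lia.
    have e2 : S4 f.+3 = 1 by rewrite /S4 /= upd_same.
    have e3 : S4 f.+1 = fold_acc input M env i b x.+1.
      by rewrite /S4 /= upd_other /S3 /= ?upd_same ?w3 //; lia.
    have e4 : S4 f = B.
      by rewrite /S4 /= upd_other /S3 /= ?upd_other ?g2 ?i3 //; lia.
    split.
    * apply: (frame_trans (leqnn f) i1).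
      by move=> r Hr; rewrite /S5 /S4 /S3 /= !upd_other ?g2 //; lia.
    * by rewrite /S5 /= upd_same e1 e2 addn1.
    * by rewrite /S5 /= upd_other ?e4 //; lia.
    * by rewrite /S5 /= upd_other ?e3 //; lia.
  have t1 := reach_step R4 C2; set R5 := effect _ _ in t1; rewrite /= in t1.
  have v5 : R5 f.+3 = 0 by rewrite /R5 /= upd_same i2 i3 subnn.
  have t2 := reach_step R5 C3; rewrite /= v5 /= in t2.
  have t3 := reach_step R5 C8; set R6 := effect _ _ in t3; rewrite /= in t3.
  exists R6; split.
  + rewrite /= -/B.
    have -> : forall s, cost input M env l + cost input M env i + s + 4 =
      cost input M env l + (cost input M env i + (1 + (s + (1 + (1 + 1))))) by lia.
    apply: (reach_trans r1); apply: (reach_trans r2); apply: (reach_trans r3).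
    apply: (reach_trans r4); apply: (reach_trans t1); apply: (reach_trans t2).
    move: t3; congr reach; rewrite /q /lb; lia.
  + by rewrite /R6 /= upd_same /R5 /= upd_other ?i4 //; lia.
  + apply: (frame_trans (leqnn f) f1); apply: (frame_trans (leqnn f) i1).
    by move=> r Hr; rewrite /R6 /R5 /= !upd_other //; lia.
- move=> /code_at_cat[Ca]; rewrite size_compile => /code_at_cat[Cb].
  rewrite size_compile => /code_at_cat[Cc]; rewrite size_compile.
  move=> /code_at_cat[Cd]; rewrite size_compile => /code_at_cat[Cg].
  rewrite size_compile => /code_at_cons[Ce _] Hctx HK HM He.
  (* All arguments are evaluated in states that agree with [R] below [f] and on the table, hence in
     the caller's environment. *)
  have next e f' S : frame K f R S -> f <= f' -> f' + scratch e <= K ->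
      compiles_to K e -> forall p, code_at p (compile K p ctx f' e) ->
      exists S', [/\ reach (cost input M env e) p S (p + code_size e) S',
                   S' f' = eval input M env e, frame K f' S S' & frame K f R S'].
    move=> HS Hf Hs Hc' p' Cp.
    have [||||S' [h1 h2 h3]] := Hc' _ _ _ S M env Cp.
    * exact: all_ltn_trans Hctx.
    * by [].
    * by move=> m; rewrite HS ?HM //; lia.
    * by rewrite (frame_map Hctx HS).
    by exists S'; split=> //; apply: frame_trans HS h3.
  have [|R1 [r1 v1 h1 f1]] := next a f R (@frame_refl K f R) (leqnn _) _ Ha _ Ca; first by lia.
  have [||R2 [r2 v2 h2 f2]] := next b f.+1 R1 f1 _ _ Hb _ Cb; try lia.
  have [||R3 [r3 v3 h3 f3]] := next c f.+2 R2 f2 _ _ Hc _ Cc; try lia.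
  have [||R4 [r4 v4 h4 f4]] := next d f.+3 R3 f3 _ _ Hd _ Cd; try lia.
  have [||||R5 [r5 v5 f5]] := Hg _ _ _ R4 M [:: eval input M env a; eval input M env b;
     eval input M env c; eval input M env d] Cg.
  + by rewrite /= !ltnS !leqnn; lia.
  + by lia.
  + by move=> m; rewrite f4 ?HM //; lia.
  + rewrite /= v4 (h4 f.+2) ?v3 ?(h4 f.+1) ?(h3 f.+1) ?v2 ?(h4 f) ?(h3 f) ?(h2 f) ?v1 //; lia.
  have r6 := reach_step R5 Ce.
  exists (effect (Move f f.+4) R5); split.
  + rewrite -!addnA.
    apply: (reach_trans r1); apply: (reach_trans r2); apply: (reach_trans r3).
    apply: (reach_trans r4); apply: (reach_trans r5).
    by move: r6; congr reach => /=; lia.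
  + by rewrite /= upd_same v5.
  + by move=> r Hr; rewrite /= upd_other ?f5 ?f4 //; lia.
Qed.

End Machine.

(** * The program that fills the table *)

Section TableProgram.
Variables eN eE eOut : expr.

Let K := 6 + scratch eN + scratch eE + scratch eOut.

(** Register 1 holds the number of cells, 2 the current cell, 3 the loop test, 4 the new value and 5
    its address; the summand 6 in [K] keeps them below the table. *)
Definition table_program : program :=
  let p := code_size eN + 1 in
  let q := p + code_size eE + 8 in
  compile K 0 [::] 1 eN ++
  [:: Const 2 0; Isub 3 1 2; Jzero 3 q] ++
  compile K p.+2 [:: 2] 4 eE ++
  [:: Const 5 K; Iadd 5 5 2; Istore 5 4; Const 5 1; Iadd 2 2 5; Jump p] ++
  compile K q [:: 1] 4 eOut ++ [:: Move 0 4; Halt].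

Variable input : seq nat.

Fixpoint table (m : nat) : nat -> nat :=
  if m is m'.+1 then upd (table m') m' (eval input (table m') [:: m'] eE)
  else fun=> 0.

Let N := eval input (fun=> 0) [::] eN.

Definition table_time :=
  cost input (fun=> 0) [::] eN +
  \sum_(m < N) (cost input (table m) [:: val m] eE + 8) +
  cost input (table N) [:: N] eOut + 4.

Lemma table_programP :
  exists m, [/\ m <= table_time,
    halted table_program (run table_program input m)
    & reg (run table_program input m) 0 = eval input (table N) [:: N] eOut].
Proof.
set P := table_program.
have : code_at P 0 P by [].
rewrite {2}/P /table_program.
set p := code_size eN + 1; set q := p + code_size eE + 8.
move=> /code_at_cat[CN]; rewrite size_compile add0n.
move=> /code_at_cons[C1] /code_at_cons[C2] /code_at_cons[C3].
move=> /code_at_cat[CE]; rewrite size_compile.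
move=> /code_at_cons[C4] /code_at_cons[C5] /code_at_cons[C6].
move=> /code_at_cons[C7] /code_at_cons[C8] /code_at_cons[C9].
move=> /code_at_cat[CO]; rewrite size_compile.
move=> /code_at_cons[C10] /code_at_cons[C11 _].
have [||||R1 [r1 v1 f1]] := @compileP P input K eN 0 [::] 1 (fun=> 0) (fun=> 0) [::] CN.
- by [].
- by rewrite /K; lia.
- by [].
- by [].
rewrite -/N add0n in v1 r1.
have r2 := reach_step input R1 C1; set R2 := effect _ _ _ in r2; rewrite /= in r2.
have Ep : (code_size eN).+1 = p by rewrite /p; lia.
rewrite Ep in r2 C2 C3 CE C4 C5 C6 C7 C8 C9 CO C10 C11.
pose inv x (R : nat -> nat) := [/\ R 1 = N, R 2 = x & forall m, R (K + m) = table x m].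
have inv_start : inv 0 R2.
  split.
  - by rewrite /R2 /= upd_other // v1.
  - by rewrite /R2 /= upd_same.
  - by move=> m; rewrite /R2 /= upd_other ?f1 // /K; lia.
have [x S0 Hx [i1 i2 i3]|R3 [r3 [i1 i2 i3]]] := @reach_loop P input inv (fun x =>
      cost input (table x) [:: x] eE + 8) p N R2 inv_start.
  have s1 := reach_step input S0 C2; set S1 := effect _ _ _ in s1; rewrite /= in s1.
  have v5 : S1 3 = N - x by rewrite /S1 /= upd_same i2 i1.
  have s2 := reach_step input S1 C3; rewrite /= v5 ifF in s2; last by lia.
  have g1 : frame K 3 S0 S1 by apply: frame_upd; rewrite /K; lia.
  have [||||S2 [s3 w3 g3]] := @compileP P input K eE _ _ _ S1 (table x) [:: x] CE.
  - by [].
  - by rewrite /K; lia.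
  - by move=> m; rewrite g1 ?i3 //; lia.
  - by rewrite /= g1 // i2.
  have g2 : frame K 3 S0 S2 by exact: frame_trans g1 g3.
  have s4 := reach_step input S2 C4; set S3 := effect _ _ _ in s4; rewrite /= in s4.
  have s5 := reach_step input S3 C5; set S4 := effect _ _ _ in s5; rewrite /= in s5.
  have s6 := reach_step input S4 C6; set S5 := effect _ _ _ in s6; rewrite /= in s6.
  have s7 := reach_step input S5 C7; set S6 := effect _ _ _ in s7; rewrite /= in s7.
  have s8 := reach_step input S6 C8; set S7 := effect _ _ _ in s8; rewrite /= in s8.
  have s9 := reach_step input S7 C9; rewrite /= in s9.
  exists S7; split.
    have -> : cost input (table x) [:: x] eE + 8 =
      1 + (1 + (cost input (table x) [:: x] eE + (1 + (1 + (1 + (1 + (1 + 1))))))).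
      by lia.
    apply: (reach_trans s1); apply: (reach_trans s2); apply: (reach_trans s3).
    apply: (reach_trans s4); apply: (reach_trans s5); apply: (reach_trans s6).
    by apply: (reach_trans s7); apply: (reach_trans s8).
  have K5 : 6 <= K by rewrite /K; lia.
  have e1 : S4 5 = K + x by rewrite /S4 /= upd_same /S3 /= upd_same upd_other ?g2 ?i2.
  have e2 : S4 4 = eval input (table x) [:: x] eE.
    by rewrite /S4 /= upd_other // /S3 /= upd_other.
  have e3 r : r != 5 -> S5 r = if r == K + x then S4 4 else S2 r.
    by move=> Hr; rewrite /S5 /= /upd e1 /S4 /S3 /=; case: ifP; rewrite !upd_other.
  have e4 r : r != 5 -> r != 2 -> S7 r = if r == K + x then S4 4 else S2 r.
    by move=> H5 H2; rewrite /S7 /= upd_other // /S6 /= upd_other // e3.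
  split.
  - by rewrite e4 // ?ifF ?g2 //; lia.
  - rewrite /S7 /= upd_same /S6 /= upd_same upd_other // e3 // ?ifF ?g2 // ?i2 ?addn1 //.
  - move=> m; rewrite e4; try lia.
    by rewrite eqn_add2l e2 [RHS]/= /upd; case: eqP => // _; rewrite g2 ?i3 //; lia.
have t1 := reach_step input R3 C2; set R4 := effect _ _ _ in t1; rewrite /= in t1.
have v4 : R4 3 = 0 by rewrite /R4 /= upd_same i2 i1 subnn.
have t2 := reach_step input R4 C3; rewrite /= v4 /= in t2.
have Eq : (p.+2 + code_size eE).+4.+2 = q by rewrite /q; lia.
rewrite Eq in CO C10 C11.
have [||||R5 [r5 v5 f5]] := @compileP P input K eOut _ _ _ R4 (table N) [:: N] CO.
- by [].
- by rewrite /K; lia.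
- by move=> m; rewrite /R4 /= upd_other ?i3 // /K; lia.
- by rewrite /R4 /= upd_other // i1.
have r6 := reach_step input R5 C10; set R6 := effect _ _ _ in r6; rewrite /= in r6.
exists table_time.
have -> : run P input table_time = Config (q + code_size eOut).+1 R6.
  rewrite /run /table_time -/(reach P input _ 0 (fun=> 0) _ R6).
  set s := \sum_(m < N) _.
  have -> : cost input (fun=> 0) [::] eN + s + cost input (table N) [:: N] eOut + 4 =
     cost input (fun=> 0) [::] eN + (1 + (s + (1 + (1 + (cost input (table N) [:: N] eOut + 1))))) by lia.
  apply: (reach_trans r1); apply: (reach_trans r2); apply: (reach_trans r3).
  by apply: (reach_trans t1); apply: (reach_trans t2); apply: (reach_trans r5).
split=> //; first by rewrite /halted /= C11.
Qed.

End TableProgram.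

(** * A syntactic criterion for polynomial cost *)

Definition eX : expr :=
  Add (Add (Inp (Cst 0)) (Inp (Cst 0))) (Add (Inp (Cst 1)) (Cst 2)).

Definition fold_bound (input : seq nat) : nat :=
  nth 0 input 0 + nth 0 input 0 + (nth 0 input 1 + 2).

Lemma fold_bound_gt1 input : 1 < fold_bound input.
Proof. by rewrite /fold_bound; lia. Qed.

Lemma leq_expn_self input m : m <= fold_bound input ^ m.
Proof. exact/ltnW/ltn_expl/fold_bound_gt1. Qed.

(** Only loops are restricted. The value of [eX] depends on neither the environment nor the table,
    so no bound on intermediate values is needed. *)
Inductive poly : expr -> Prop :=
  | poly_Var i : poly (Var i)
  | poly_Cst c : poly (Cst c)
  | poly_Add a b : poly a -> poly b -> poly (Add a b)
  | poly_Sub a b : poly a -> poly b -> poly (Sub a b)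
  | poly_Inp a : poly a -> poly (Inp a)
  | poly_Tab a : poly a -> poly (Tab a)
  | poly_Ite a b c : poly a -> poly b -> poly c -> poly (Ite a b c)
  | poly_Fold i b : poly i -> poly b -> poly (Fold eX i b)
  | poly_Call f a b c d :
      poly f -> poly a -> poly b -> poly c -> poly d -> poly (Call f a b c d).

(** A sum of two positive numbers is at most twice their product, and one more factor [X] absorbs
    the 2. *)
Lemma leq_expn_add X a b c d : 1 < X -> a <= X ^ c -> b <= X ^ d -> a + b <= X ^ (c + d).+1.
Proof.
move=> HX Ha Hb; rewrite expnS expnD.
have c0 : 0 < X ^ c by rewrite expn_gt0; lia.
have d0 : 0 < X ^ d by rewrite expn_gt0; lia.
by apply: (@leq_trans (2 * (X ^ c * X ^ d))); [nia | rewrite leq_mul2r; lia].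
Qed.

(** The exponents are left to unification: each summand brings its own, and a constant [m] is
    bounded by the [m]-th power of the loop bound. *)
Lemma poly_cost e : poly e -> exists c, forall input M env,
  cost input M env e <= fold_bound input ^ c.
Proof.
have X2 := fold_bound_gt1; have Xc := leq_expn_self.
elim=> {e} /=.
- by move=> i; exists 1 => *; rewrite expn1 ltnW.
- by move=> i; exists 1 => *; rewrite expn1 ltnW.
- by move=> a b _ [x Hx] _ [y Hy]; eexists=> input M env; do 2?[apply: leq_expn_add].
- by move=> a b _ [x Hx] _ [y Hy]; eexists=> input M env; do 2?[apply: leq_expn_add].
- by move=> a _ [x Hx]; eexists=> input M env; apply: leq_expn_add.
- by move=> a _ [x Hx]; eexists=> input M env; apply: leq_expn_add.
- move=> a b c _ [x Hx] _ [y Hy] _ [z Hz]; eexists=> input M env.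
  apply: (@leq_trans (cost input M env a + (cost input M env b + cost input M env c + 2))).
    by case: ifP; lia.
  by do 3?[apply: leq_expn_add].
- move=> i b _ [x Hx] _ [y Hy]; eexists=> input M env.
  set s := \sum_(_ < _) _.
  apply: (@leq_trans (15 + cost input M env i + s)); first by rewrite /s; lia.
  apply: leq_expn_add => //; first exact: leq_expn_add.
  rewrite /s -/(fold_bound input).
  apply: (@leq_trans (fold_bound input * fold_bound input ^ (y + 6).+1)); last first.
    by rewrite -expnS.
  rewrite -[X in _ <= X * _]card_ord -sum_nat_const; apply: leq_sum => u _.
  exact: leq_expn_add.
- move=> f a b c d _ [x Hx] _ [y Hy] _ [z Hz] _ [u Hu] _ [v Hv].
  by eexists=> input M env; do 5?[apply: leq_expn_add].
Qed.

(** * The states of one vertex *)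

Section OneVertex.
Variables T k l : nat.

(* A vertex is in state [(c, r)] if [c] of its intervals have started and it   *)
(* stays active for [r] more time steps, the current one included.  The bits   *)
(* [A] and [A'] tell whether it is in the bags before and after the step into  *)
(* time [a].                                                                   *)
Definition vertex_ok (A A' : bool) (c r c' r' : nat) : bool :=
  if A' then
    if A then ((c' == c) && (r' == r - 1)) || ((c' == c + 1) && (r' == l + 1))
    else r' <= c' * (l + 1)
  else true.

Definition vertex_gain (a : nat) (A A' : bool) (c r c' r' dom : nat) : nat :=
  if A' then (if A then 0 else minn a (c' * (l + 1) - r')) + dom
  else if A then minn (T - a) (r - 1 + (k - c) * (l + 1)) else 0.

Section Schedule.
Variable S : nat -> bool.

(** At layer [a] the times before [a] are decided. A start during a running interval resets the
    remaining time instead of adding to it. *)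
Fixpoint starts (a : nat) : nat := if a is a'.+1 then starts a' + S a' else 0.
Fixpoint remaining (a : nat) : nat :=
  if a is a'.+1 then if S a' then l + 1 else remaining a' - 1 else 0.

Lemma startsE a : starts a = \sum_(0 <= i < a) S i.
Proof. by elim: a => [|a IH]; [rewrite big_geq | rewrite big_nat_recr //= IH]. Qed.

Lemma remaining_le a : remaining a <= l + 1.
Proof. by elim: a => [|a IH] //=; case: ifP; lia. Qed.

Lemma remaining_cover s i : S s -> s <= i <= s + l -> 0 < remaining i.+1.
Proof.
move=> Ss /andP[si il].
suff: forall d, d <= l -> l + 1 - d <= remaining (s + d).+1.
  by move=> /(_ (i - s)); rewrite subnKC //; lia.
elim=> [|d IH] dl; first by rewrite addn0 /= Ss; lia.
by move: (IH (ltnW dl)); rewrite (addnS s d); move: (s + d).+1 => y /=; case: ifP; lia.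
Qed.

Definition active_count a := \sum_(0 <= i < a) (0 < remaining i.+1 : nat).

Lemma active_countS a : active_count a.+1 = active_count a + (0 < remaining a.+1).
Proof. by rewrite /active_count big_nat_recr. Qed.

(** Each start pays for at most [l + 1] active steps. The subtracted 1 is the current time [a - 1],
    which [active_count a] already includes. *)
Lemma active_count_remaining a : active_count a + (remaining a - 1) <= starts a * (l + 1).
Proof.
elim: a => [|a IH]; first by rewrite /active_count big_geq.
rewrite active_countS /=; move: IH; case: (S a) => /=; rewrite ?mulnDl; lia.
Qed.

(** This yields the entry condition of [vertex_ok] for schedules and shows that the gain credited on
    entry covers the activity so far. *)
Lemma active_count_enter a : active_count a + remaining a.+1 <= starts a.+1 * (l + 1).
Proof. by have := active_count_remaining a.+1; rewrite active_countS; lia. Qed.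

Lemma active_count_le a : active_count a <= a.
Proof. by elim: a => [|a IH]; [rewrite /active_count big_geq | rewrite active_countS; lia]. Qed.

Hypothesis card_S : \sum_(0 <= i < T) S i <= k.

Lemma starts_le a : a <= T -> starts a <= k.
Proof.
move=> aT; apply: leq_trans card_S; rewrite startsE.
by rewrite (@big_cat_nat _ _ _ a 0 T) ?leq_addr.
Qed.

Lemma potential_step a : a < T ->
  (0 < remaining a.+1) + minn (T - a.+1) (remaining a.+1 - 1 + (k - starts a.+1) * (l + 1))
  <= minn (T - a) (remaining a - 1 + (k - starts a) * (l + 1)).
Proof.
move=> aT; have := @starts_le a.+1 aT; rewrite /=; case: (S a) => /= Hk; last by nia.
have -> : k - starts a = (k - (starts a + 1)) + 1 by lia.
by rewrite mulnDl; lia.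
Qed.

End Schedule.

Definition covers (L : seq nat) (i : nat) : bool :=
  has (fun s => s <= i <= s + l) L.

Lemma covers_cat L1 L2 i : covers (L1 ++ L2) i = covers L1 i || covers L2 i.
Proof. exact: has_cat. Qed.

(** Intervals packed back to back and ending just before [e]. A block that would start before time 0
    is moved to 0 by the truncated subtraction and still covers all it should. *)
Definition blocks_before (e c : nat) : seq nat :=
  [seq e - j * (l + 1) | j <- iota 1 c].

Definition blocks_after (b c : nat) : seq nat :=
  [seq b + j * (l + 1) | j <- iota 0 c].

Lemma blocks_after_covers b c i :
  b <= i < b + c * (l + 1) -> covers (blocks_after b c) i.
Proof.
move=> /andP[bi ic]; apply/hasP; exists (b + (i - b) %/ (l + 1) * (l + 1)).
  apply/mapP; exists ((i - b) %/ (l + 1)) => //.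
  by rewrite mem_iota /= add0n ltn_divLR; lia.
have := divn_eq (i - b) (l + 1); have := @ltn_pmod (i - b) (l + 1) _.
by rewrite addn1 => /(_ isT); lia.
Qed.

Lemma blocks_before_covers e c i :
  e <= i + c * (l + 1) -> i < e -> covers (blocks_before e c) i.
Proof.
move=> ei ie; set y := e - i - 1.
apply/hasP; exists (e - (y %/ (l + 1)).+1 * (l + 1)).
  apply/mapP; exists (y %/ (l + 1)).+1 => //.
  by rewrite mem_iota /= add1n ltnS ltn_divLR; rewrite /y; lia.
have := divn_eq y (l + 1); have := @ltn_pmod y (l + 1) _.
by rewrite addn1 mulSn => /(_ isT); rewrite /y; lia.
Qed.

Lemma sum_true_ge (Q : nat -> bool) b e :
  (forall i, b <= i < e -> Q i) -> e - b <= \sum_(b <= i < e) Q i.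
Proof.
move=> H; rewrite (@eq_big_nat _ _ _ _ _ _ (fun=> 1)) ?sum_nat_const_nat ?muln1 //.
by move=> i Hi; rewrite H.
Qed.

(** These are instantiated with [appeared v] and [pending v]; the hypotheses make the layers with
    [F] an interval. *)
Variables pre post : nat -> bool.
Hypothesis pre0 : pre 0 = false.
Hypothesis preS : forall a, pre a -> pre a.+1.
Hypothesis postS : forall a, post a.+1 -> post a.
Hypothesis pre_post : forall a, ~~ pre a -> pre a.+1 -> post a.+1.
Hypothesis post_end : forall a, T < a -> post a = false.

Let F a := pre a && post a.

Section FromSchedule.
Variable S : nat -> bool.
Hypothesis card_S : \sum_(0 <= i < T) S i <= k.

Variable dom : nat -> bool.
Hypothesis dom_isolated : forall a, a < T -> ~~ F a.+1 -> dom a = (0 < remaining S a.+1).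

Lemma schedule_gain :
  \sum_(0 <= a < T) dom a <=
  \sum_(0 <= a < T)
     vertex_gain a (F a) (F a.+1) (starts S a) (remaining S a)
        (starts S a.+1) (remaining S a.+1) (dom a)
  + (if pre T then 0 else minn T (k * (l + 1))).
Proof.
pose g a := vertex_gain a (F a) (F a.+1) (starts S a) (remaining S a)
        (starts S a.+1) (remaining S a.+1) (dom a).
pose D a := \sum_(0 <= a < a) (dom a : nat); pose Gn a := \sum_(0 <= a < a) g a.
have DS a : D a.+1 = D a + dom a by rewrite /D big_nat_recr.
have GS a : Gn a.+1 = Gn a + g a by rewrite /Gn big_nat_recr.
(* Three phases: before the bags nothing is credited; inside them the credit covers what is
   dominated; after them it also covers the potential, because the exit gain is paid in advance. *)
have inv a : a <= T ->
    if ~~ pre a then D a = active_count S a /\ Gn a = 0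
    else if post a then D a <= Gn a
    else D a + minn (T - a) (remaining S a - 1 + (k - starts S a) * (l + 1)) <= Gn a.
  elim: a => [|a IH] aT; first by rewrite pre0 /D /active_count /Gn !big_geq.
  have := IH (ltnW aT); have := dom_isolated aT; have := @potential_step S card_S a aT.
  have := active_count_enter S a; have := active_count_le S a.
  rewrite DS active_countS GS /g /vertex_gain /F.
  have := @preS a; have := @postS a; have := @pre_post a.
  case: (pre a); case: (pre a.+1); case: (post a); case: (post a.+1);
    rewrite /= => // h1 h2 h3 h4 h5 h6 h7; try (by have := h1 isT isT);
    try (by have := h2 isT); try (by have := h3 isT); try (rewrite (h7 isT)); try lia.
have := inv T (leqnn T); have := active_count_remaining S T; have := active_count_le S T.
have := @starts_le S card_S T (leqnn T); rewrite -/(D T) -/(Gn T).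
case: (pre T); case: (post T) => /= hs h1 h2 h3; try lia; case: h3 => -> ->; nia.
Qed.

End FromSchedule.

Section FromPath.
Variables (c r : nat -> nat) (dom : nat -> bool).
Hypothesis c_le : forall a, c a <= k.
Hypothesis path_ok :
  forall a, a <= T -> vertex_ok (F a) (F a.+1) (c a) (r a) (c a.+1) (r a.+1).

Fixpoint path_starts (a : nat) : seq nat :=
  if a is b.+1 then
    path_starts b ++
      if F a then
        if F b then if c a == c b then [::] else [:: b]
        else blocks_before (b + r a) (c a)
      else if F b then blocks_after (b + (r b - 1)) (k - c b) else [::]
  else [::].

Lemma path_gain :
  pre T ->
  let L := path_starts T.+1 in
  [/\ size L <= k,
      forall a, a < T -> F a.+1 -> 0 < r a.+1 -> covers L a
    & \sum_(0 <= a < T.+1)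
         vertex_gain a (F a) (F a.+1) (c a) (r a) (c a.+1) (r a.+1) (dom a)
      <= \sum_(0 <= a < T) (if F a.+1 then dom a else covers L a)].
Proof.
move=> preT /=.
pose g a := vertex_gain a (F a) (F a.+1) (c a) (r a) (c a.+1) (r a.+1) (dom a).
pose Gn a := \sum_(0 <= a < a) g a.
have GS a : Gn a.+1 = Gn a + g a by rewrite /Gn big_nat_recr.
pose val L i : nat := if F i.+1 then dom i else covers L i.
have val_mono L L' i : val L i <= val (L ++ L') i.
  by rewrite /val covers_cat; case: ifP => // _; case: (covers L i).
have sum_mono L L' a b : \sum_(a <= i < b) val L i <= \sum_(a <= i < b) val (L ++ L') i.
  by apply: leq_sum => i _; apply: val_mono.
(* Later starts only add coverage, so the clauses concern the list built so far. The third one says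
   that the announced remaining activity is already covered. After the exit all intervals are
   placed, hence [k] as size bound and the sum up to [T]. *)
have inv a : a <= T.+1 ->
    let L := path_starts a in
    if ~~ pre a then L = [::] /\ Gn a = 0
    else [/\ size L <= (if post a then c a else k),
             forall i, i < a -> F i.+1 -> 0 < r i.+1 -> covers L i,
             post a -> forall x, a <= x.+1 -> x.+1 < a + r a -> covers L x
           & Gn a <= \sum_(0 <= i < (if post a then a else T)) val L i].
  elim: a => [|a IH] aT /=; first by rewrite pre0 /Gn big_geq.
  move: (IH (ltnW aT)) => /=; set L := path_starts a.
  have := path_ok aT; rewrite GS /g /vertex_ok /vertex_gain.
  have := @preS a; have := @postS a; have := @pre_post a.
  have EF : F a = pre a && post a by [].
  have EF' : F a.+1 = pre a.+1 && post a.+1 by [].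
  case: (boolP (F a)) EF => HFa EF; case: (boolP (F a.+1)) EF' => HFb EF'.
  - have [pa oa] : pre a /\ post a by apply/andP.
    have [pb ob] : pre a.+1 /\ post a.+1 by apply/andP.
    rewrite pa pb oa ob /= => _ _ _ ok [h1 h2 h3 h4].
    set L' := if _ == _ then _ else _.
    have h5 x : a < x.+1 -> x.+1 < a.+1 + r a.+1 -> covers (L ++ L') x.
      move=> H1 H2; rewrite covers_cat /L'; case: (c a.+1 =P c a) ok => E.
        by move=> ok; rewrite h3 //; lia.
      by move=> ok; apply/orP; right; rewrite /covers /= orbF; lia.
    split=> //.
    + by rewrite size_cat /L'; case: eqP ok => //= E ok; lia.
    + move=> i; rewrite ltnS leq_eqVlt => /orP[/eqP-> _ ri|ia Fi ri].
        by apply: h5 => //; lia.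
      by rewrite covers_cat h2.
    + rewrite big_nat_recr //= {2}/val HFb.
      have := sum_mono L L' 0 a; lia.
  - have [pa oa] : pre a /\ post a by apply/andP.
    rewrite pa oa /= => _ _ /(_ isT) pb _; rewrite pb.
    rewrite pb /= in EF'; rewrite -EF' => -[h1 h2 h3 h4].
    have aT' : a <= T by [].
    set L' := blocks_after _ _.
    have cov x : a <= x < a + (r a - 1 + (k - c a) * (l + 1)) -> covers (L ++ L') x.
      move=> Hx; rewrite covers_cat; case: (ltnP x.+1 (a + r a)) => H.
        by rewrite h3 //; lia.
      by rewrite orbC blocks_after_covers //; lia.
    split=> //.
    + by rewrite size_cat size_map size_iota; have := c_le a; lia.
    + move=> i; rewrite ltnS leq_eqVlt => /orP[/eqP->|ia Fi ri].
        by rewrite (negbTE HFb).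
      by rewrite covers_cat h2.
    + rewrite (@big_cat_nat _ _ _ a 0 T) //=.
      apply: leq_add; first exact: leq_trans h4 (sum_mono _ _ _ _).
      set m := minn _ _.
      have am : a <= a + m <= T by rewrite /m; lia.
      rewrite (@big_cat_nat _ _ _ (a + m) a T) /=; try lia.
      apply: leq_trans (leq_addr _ _).
      apply: (@leq_trans (\sum_(a <= i < a + m) (covers (L ++ L') i : nat))).
        apply: leq_trans (sum_true_ge _); first by lia.
        by move=> i Hi; apply: cov; rewrite /m in Hi; lia.
      rewrite big_nat [X in _ <= X]big_nat.
      apply: leq_sum => i /andP[ai _]; rewrite /val ifF //.
      (* [post] is closed downwards, so a vertex that has left the bags does not return. *)
      apply/negP => /andP[_ Ho].
      have : post a.+1.
        move: Ho; have -> : i.+1 = a.+1 + (i - a) by lia.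
        by elim: (i - a) => [|d IHd]; rewrite ?addn0 // addnS => /postS.
      by rewrite -EF'.
  - have [pb ob] : pre a.+1 /\ post a.+1 by apply/andP.
    rewrite pb ob /= => _ /(_ isT) oa _ ok.
    have pa : ~~ pre a by move: EF; rewrite oa andbT => /esym/negbT.
    rewrite pa => -[EL EG]; rewrite EL EG /=.
    set L' := blocks_before _ _.
    have cov x : a + r a.+1 <= x + c a.+1 * (l + 1) -> x < a + r a.+1 -> covers L' x.
      exact: blocks_before_covers.
    have Fi i : i < a -> F i.+1 = false.
      move=> ia; apply/negP => /andP[Hp _]; move: pa.
      have -> : a = i.+1 + (a - i.+1) by lia.
      by elim: (a - i.+1) => [|d IHd]; rewrite ?addn0 ?Hp // addnS => /(contra (@preS _)).
    split=> //.
    + by rewrite size_map size_iota.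
    + move=> i; rewrite ltnS leq_eqVlt => /orP[/eqP-> _ ri|ia].
        by apply: cov; lia.
      by rewrite Fi.
    + by move=> _ x H1 H2; apply: cov; lia.
    + rewrite big_nat_recr //= add0n {2}/val HFb leq_add2r.
      rewrite (@eq_big_nat _ _ _ _ _ _ (fun i => covers L' i : nat)); last first.
        by move=> i Hi; rewrite /val Fi.
      set m := minn _ _.
      rewrite (@big_cat_nat _ _ _ (a - m) 0 a) //=; try lia.
      apply: leq_trans (leq_addl _ _).
      apply: leq_trans (sum_true_ge _); first by rewrite /m; lia.
      by move=> i Hi; apply: cov; rewrite /m in Hi; lia.
  - rewrite cats0 addn0.
    case: (boolP (pre a)) EF => pa /=.
      move=> /esym/negbT/negbTE oa _ Ho /(_ isT) pb _; rewrite pb oa /=.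
      have ob : post a.+1 = false by apply/negP => /Ho; rewrite oa.
      rewrite ob => -[h1 h2 _ h4]; split=> //.
      move=> i; rewrite ltnS leq_eqVlt => /orP[/eqP->|]; last exact: h2.
      by rewrite (negbTE HFb).
    move=> _ /(_ isT) Hpo _ _ _; case: (boolP (pre a.+1)) EF' => //= pb.
    by rewrite (Hpo pb).
have pT : pre T.+1 by exact: preS.
have := inv T.+1 (leqnn _); rewrite /= pT post_end //= => -[h1 h2 _ h4]; split=> //.
by move=> a aT; apply: h2; apply: ltnW.
Qed.

End FromPath.
End OneVertex.

(** * The dynamic program *)

Section MixedRadix.
Variable radix : nat -> nat.
Hypothesis radix_gt0 : forall z, 0 < radix z.

Definition weight (z : nat) : nat := \prod_(0 <= y < z) radix y.
Definition digit (j z : nat) : nat := (j %% weight z.+1) %/ weight z.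
Definition code (f : nat -> nat) (z : nat) : nat :=
  \sum_(0 <= y < z) f y * weight y.

Lemma weightS z : weight z.+1 = weight z * radix z.
Proof. by rewrite /weight big_nat_recr. Qed.

Lemma weight_gt0 z : 0 < weight z.
Proof. by elim: z => [|z IH]; [rewrite /weight big_geq | rewrite weightS muln_gt0 IH radix_gt0]. Qed.

Lemma digit_lt j z : digit j z < radix z.
Proof. by rewrite /digit ltn_divLR ?weight_gt0 // mulnC -weightS ltn_mod weight_gt0. Qed.

Lemma codeS f z : code f z.+1 = code f z + f z * weight z.
Proof. by rewrite /code big_nat_recr. Qed.

Lemma code_lt f z : (forall y, y < z -> f y < radix y) -> code f z < weight z.
Proof.
elim: z => [|z IH] H; first by rewrite /code /weight !big_geq.
have := IH (fun y Hy => H y (ltnW Hy)); have := H z (ltnSn z).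
by rewrite codeS weightS; nia.
Qed.

Lemma weight_dvd y z : y <= z -> weight y %| weight z.
Proof.
move=> yz; rewrite -(subnKC yz); elim: (z - y) => [|d IH]; first by rewrite addn0.
by rewrite addnS weightS dvdn_mulr.
Qed.

Lemma digit_code f z y :
  (forall y, y < z -> f y < radix y) -> y < z -> digit (code f z) y = f y.
Proof.
move=> H yz.
have -> : digit (code f z) y = (code f y.+1) %/ weight y.
  rewrite /digit; congr (_ %/ _).
  rewrite -[RHS](@modn_small _ (weight y.+1)); last first.
    by apply: code_lt => x xy; apply: H; apply: leq_trans xy yz.
  rewrite -(subnKC yz); elim: (z - y.+1) => [|d IH]; first by rewrite addn0.
  rewrite addnS codeS.
  have /dvdnP[w ->] := @weight_dvd y.+1 (y.+1 + d) (leq_addr _ _).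
  by rewrite mulnA addnC modnMDl.
rewrite codeS divnDMl ?weight_gt0 // divn_small //.
by apply: code_lt => x xy; apply: H; apply: ltn_trans xy yz.
Qed.

End MixedRadix.

(** * The recurrence and its correctness *)

Section DynamicProgram.
Variables (n T k l : nat) (adj : nat -> nat -> nat -> bool).

Definition noniso (i v : nat) : bool := [exists u : 'I_n, adj i v u].
Definition appeared (v a : nat) : bool :=
  [exists p : 'I_T, noniso p v && (p < a)].
Definition pending (v a : nat) : bool :=
  [exists q : 'I_T, noniso q v && (a <= q.+1)].
(* Layer [a] is the bag at time [a - 1]; the layers [0] and [T + 1] are empty. *)
Definition in_bag (a v : nat) : bool := appeared v a && pending v a.

Lemma appeared0 v : appeared v 0 = false.
Proof. by apply/existsP => -[p]; rewrite andbF. Qed.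

Lemma appearedS v a : appeared v a -> appeared v a.+1.
Proof. by move=> /existsP[p /andP[H1 H2]]; apply/existsP; exists p; rewrite H1 /=; lia. Qed.

Lemma pendingS v a : pending v a.+1 -> pending v a.
Proof. by move=> /existsP[p /andP[H1 H2]]; apply/existsP; exists p; rewrite H1 /=; lia. Qed.

Lemma appeared_pending v a : ~~ appeared v a -> appeared v a.+1 -> pending v a.+1.
Proof.
move=> H /existsP[p /andP[H1 H2]]; apply/existsP; exists p; rewrite H1 /=.
by rewrite leqNgt ltnS; apply: contra H => H3; apply/existsP; exists p; rewrite H1.
Qed.

Lemma pending_end v a : T < a -> pending v a = false.
Proof. by move=> Ha; apply/existsP => -[p /andP[_ H]]; have := ltn_ord p; lia. Qed.

Lemma appeared_end v a : appeared v a -> appeared v T.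
Proof. by move=> /existsP[p /andP[H _]]; apply/existsP; exists p; rewrite H ltn_ord. Qed.

Lemma noniso_in_bag i v : i < T -> noniso i v -> in_bag i.+1 v.
Proof.
move=> iT H; apply/andP; split; apply/existsP; exists (Ordinal iT); by rewrite H /=.
Qed.

(* A state of a layer is coded by a number in mixed radix, whose digits [v] and  *)
(* [n + v] hold the two components of the state of vertex [v].                  *)
Definition radix (a z : nat) : nat :=
  if z < n then if in_bag a z then k + 1 else 1
  else if in_bag a (z - n) then l + 2 else 1.

Lemma radix_gt0 a z : 0 < radix a z.
Proof. by rewrite /radix; case: ifP; case: ifP; lia. Qed.

Definition width (a : nat) : nat := weight (radix a) (n + n).

Definition st_count (a j v : nat) : nat := digit (radix a) j v.
Definition st_rem (a j v : nat) : nat := digit (radix a) j (n + v).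

Lemma st_count_le a j v : v < n -> st_count a j v <= k.
Proof.
move=> vn; have := digit_lt (radix_gt0 a) j v; rewrite -/(st_count a j v) /radix vn.
by case: ifP; lia.
Qed.

Definition dominates (a j v : nat) : bool :=
  [exists u : 'I_n, [&& in_bag a.+1 u, 0 < st_rem a.+1 j u
                      & (val u == v) || adj a u v]].

Definition step_ok_at (a j j' v : nat) : bool :=
  vertex_ok l (in_bag a v) (in_bag a.+1 v) (st_count a j v) (st_rem a j v)
    (st_count a.+1 j' v) (st_rem a.+1 j' v).

Definition step_gain_at (a j j' v : nat) : nat :=
  vertex_gain T k l a (in_bag a v) (in_bag a.+1 v) (st_count a j v)
    (st_rem a j v) (st_count a.+1 j' v) (st_rem a.+1 j' v) (dominates a j' v).

Definition step_ok (a j j' : nat) : bool := [forall v : 'I_n, step_ok_at a j j' v].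
Definition step_gain (a j j' : nat) : nat := \sum_(v < n) step_gain_at a j j' v.

(* One plus the best gain of a path ending in state [j] of layer [a], or 0 if   *)
(* there is no such path.                                                       *)
Fixpoint best (a j : nat) : nat :=
  if a is b.+1 then
    \max_(i < width b)
      (if (best b i != 0) && step_ok b i j then best b i + step_gain b i j else 0)
  else 1.

(** A vertex in no bag is isolated at all times, so its best contribution is independent of the
    table. *)
Definition isolated_gain (v : nat) : nat :=
  if appeared v T then 0 else minn T (k * (l + 1)).

Definition optimum : nat := best T.+1 0 - 1 + \sum_(v < n) isolated_gain v.

Definition is_path (A : nat) (js : nat -> nat) : Prop :=
  forall a, a < A -> js a < width a /\ step_ok a (js a) (js a.+1).

Lemma path_le_best A js :
  is_path A js -> 1 + \sum_(0 <= a < A) step_gain a (js a) (js a.+1) <= best A (js A).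
Proof.
elim: A => [|A IH] H; first by rewrite big_geq.
have [HA okA] := H A (ltnSn A).
have {}IH := IH (fun a Ha => H a (ltnW Ha)).
rewrite big_nat_recr //= addnA.
apply: leq_trans (leq_bigmax_cond (Ordinal HA) _) => //=.
by rewrite okA andbT ifT; lia.
Qed.

Lemma best_path A j : 0 < best A j ->
  exists js, [/\ js A = j, is_path A js
    & best A j = 1 + \sum_(0 <= a < A) step_gain a (js a) (js a.+1)].
Proof.
elim: A j => [|A IH] j Hj; first by exists (fun=> j); split=> //; rewrite big_geq.
have w0 : 0 < width A by apply: weight_gt0; apply: radix_gt0.
have [|i Ei] := @eq_bigmax _ (fun i : 'I_(width A) =>
  if (best A i != 0) && step_ok A i j then best A i + step_gain A i j else 0).
  by rewrite card_ord.
move: Hj; rewrite /= Ei; case: ifP => // /andP[bi oki] _.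
have [|js [E1 E2 E3]] := IH i; first by rewrite lt0n.
pose js' a := if a == A.+1 then j else js a.
have Ejs a : a <= A -> js' a = js a by move=> H; rewrite /js' ifF //; lia.
have EA : js' A.+1 = j by rewrite /js' eqxx.
exists js'; split=> //.
  move=> a; rewrite ltnS leq_eqVlt => /orP[/eqP->|aA].
    by rewrite EA Ejs // E1.
  by rewrite !Ejs ?(ltnW aA) //; apply: E2.
rewrite big_nat_recr //= EA Ejs // E1 E3 addnA; congr (_ + _ + _).
by apply: eq_big_nat => a /andP[_ aA]; rewrite !Ejs // ltnW.
Qed.

(** All radices of the empty layer are 1, so the optimum is read off a single cell. *)
Lemma width_last : width T.+1 = 1.
Proof.
rewrite /width /weight big1 // => z _.
by rewrite /radix /in_bag !pending_end // !andbF; case: ifP.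
Qed.

Hypothesis adj_sym : forall i u v, i < T -> u < n -> v < n -> adj i u v = adj i v u.

Section Complete.
Variable S : nat -> nat -> bool.
Hypothesis card_S : forall v, v < n -> \sum_(0 <= i < T) S v i <= k.

Let f a z :=
  if z < n then if in_bag a z then starts (S z) a else 0
  else if in_bag a (z - n) then remaining l (S (z - n)) a else 0.

Let js a := code (radix a) (f a) (n + n).

Lemma f_lt a z : z < n + n -> f a z < radix a z.
Proof.
move=> zn; rewrite /f /radix; case: ifP => Hz; case: ifP => // /andP[_ Hp].
  have aT : a <= T by rewrite leqNgt; apply/negP => /(pending_end z); rewrite Hp.
  by have := starts_le (card_S Hz) aT; lia.
by have := remaining_le l (S (z - n)) a; lia.
Qed.

Lemma st_count_js a v : v < n -> st_count a (js a) v = if in_bag a v then starts (S v) a else 0.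
Proof.
move=> vn; rewrite /st_count digit_code; last by lia.
- by rewrite /f vn.
- exact: radix_gt0.
- exact: f_lt.
Qed.

Lemma st_rem_js a v : v < n -> st_rem a (js a) v = if in_bag a v then remaining l (S v) a else 0.
Proof.
move=> vn; rewrite /st_rem digit_code; last by lia.
- by rewrite /f ltnNge leq_addr /= addKn.
- exact: radix_gt0.
- exact: f_lt.
Qed.

Let dom i v := [exists u : 'I_n, (0 < remaining l (S u) i.+1) && ((val u == v) || adj i u v)].

(** An active [u] outside the bag is isolated at this time and cannot dominate a vertex of the bag,
    so [dominates] may ignore it. *)
Lemma dom_js a v : v < n -> a < T -> in_bag a.+1 v -> dominates a (js a.+1) v = dom a v.
Proof.
move=> vn aT Hv; apply: eq_existsb => u; rewrite st_rem_js //.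
case: (boolP (in_bag a.+1 u)) => //= Hu.
case: (val u =P v) => [E|_] /=; first by rewrite E Hv in Hu.
case: (boolP (adj a u v)) => [Huv|]; last by rewrite andbF.
suff: noniso a u by move=> /(noniso_in_bag aT); rewrite (negbTE Hu).
by apply/existsP; exists (Ordinal vn).
Qed.

Lemma dom_isolated_js a v : v < n -> a < T -> ~~ in_bag a.+1 v ->
  dom a v = (0 < remaining l (S v) a.+1).
Proof.
move=> vn aT Hv; apply/existsP/idP => [[u /andP[H1 /orP[/eqP<-//|H2]]]|H].
  case/negP: Hv; apply: noniso_in_bag => //; apply/existsP; exists u.
  by rewrite adj_sym.
by exists (Ordinal vn); rewrite H /= eqxx.
Qed.

Lemma is_path_js : is_path T.+1 js.
Proof.
move=> a aT; split; first by apply: code_lt => y; apply: f_lt.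
apply/forallP => v; rewrite /step_ok_at /vertex_ok !st_count_js ?(ltn_ord v) // !st_rem_js //.
case: (in_bag a.+1 v) => //; case: (in_bag a v) => /=; first by case: (S v a); lia.
by have := active_count_enter l (S v) a; rewrite /=; lia.
Qed.

(** After exchanging the sums, [schedule_gain] and [isolated_gain] account for each vertex
    separately; vertices interact only through [dom]. *)
Lemma dp_complete :
  \sum_(v < n) \sum_(0 <= i < T) (dom i v : nat) <= optimum /\ 0 < best T.+1 0.
Proof.
have j0 : js T.+1 = 0.
  apply/eqP; rewrite -leqn0 -ltnS -width_last.
  by apply: code_lt => y; apply: f_lt.
have := path_le_best is_path_js; rewrite j0 => Hb; split; last by lia.
apply: (@leq_trans (\sum_(0 <= a < T.+1) step_gain a (js a) (js a.+1) +
                    \sum_(v < n) isolated_gain v)); last by rewrite /optimum; lia.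
rewrite /step_gain [X in _ <= X + _]exchange_big /= -big_split /=; apply: leq_sum => v _.
have H := @schedule_gain T k l (appeared v) (pending v) (appeared0 v)
  (@appearedS v) (@pendingS v) (@appeared_pending v) (S v) (card_S (ltn_ord v))
  (fun i => dom i v) (fun a => @dom_isolated_js a v (ltn_ord v)).
apply: leq_trans H _; rewrite leq_add2r big_nat_recr //=.
apply: leq_trans (leq_addr _ _); rewrite big_nat [X in _ <= X]big_nat.
apply: leq_sum => a /andP[_ aT].
rewrite -/(in_bag a v) -/(in_bag a.+1 v) /step_gain_at /vertex_gain.
rewrite !st_count_js // !st_rem_js //.
by case: (boolP (in_bag a.+1 v)) => H'; case: (in_bag a v); rewrite ?dom_js.
Qed.

End Complete.

Lemma dp_sound : exists L : nat -> seq nat,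
  (forall v, size (L v) <= k) /\
  optimum <= \sum_(v < n) \sum_(0 <= i < T)
    ([exists u : 'I_n, covers l (L u) i && ((val u == v) || adj i u v)] : nat).
Proof.
(* The empty schedule shows that a path to the last layer exists. *)
have [|_ b0] := @dp_complete (fun _ _ => false); first by move=> v _; rewrite big1.
have [js [_ pjs Eb]] := best_path b0.
pose c v a := if v < n then st_count a (js a) v else 0.
pose r v a := st_rem a (js a) v.
pose L v := if v < n then
              if appeared v T then
                path_starts k l (appeared v) (pending v) (c v) (r v) T.+1
              else blocks_after l 0 k
            else [::].
have cE v a : v < n -> c v a = st_count a (js a) v by rewrite /c => ->.
have pg v : v < n -> appeared v T ->
  [/\ size (L v) <= k,
      forall a, a < T -> in_bag a.+1 v -> 0 < r v a.+1 -> covers l (L v) a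
    & \sum_(0 <= a < T.+1) step_gain_at a (js a) (js a.+1) v
      <= \sum_(0 <= a < T)
           (if in_bag a.+1 v then dominates a (js a.+1) v else covers l (L v) a)].
  move=> vn Hv; rewrite /L vn Hv.
  have [||h1 h2 h3] := @path_gain T k l _ _ (appeared0 v)
    (@appearedS v) (@pendingS v) (@appeared_pending v) (@pending_end v)
    (c v) (r v) (fun a => dominates a (js a.+1) v) _ _ Hv.
  - by move=> a; rewrite cE // st_count_le.
  - move=> a aT; rewrite !cE //.
    by have [_ /forallP/(_ (Ordinal vn))] := pjs a aT.
  split=> //; apply: leq_trans h3; apply: eq_leq.
  by apply: eq_bigr => a _; rewrite !cE.
exists L; split=> [v|].
  rewrite {1}/L; case: ifP => // vn; case: ifP => Hv; last by rewrite size_map size_iota.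
  by have [] := pg v vn Hv; rewrite /L vn Hv.
rewrite /optimum Eb addKn /step_gain exchange_big /= -big_split /=.
apply: leq_sum => v _; rewrite /isolated_gain.
have self i : covers l (L v) i ->
    [exists u : 'I_n, covers l (L u) i && ((val u == v) || adj i u v)].
  by move=> H; apply/existsP; exists v; rewrite H eqxx.
case: ifP => Hv.
  have [_ _ h3] := pg v (ltn_ord v) Hv; rewrite addn0; apply: leq_trans h3 _.
  rewrite big_nat [X in _ <= X]big_nat; apply: leq_sum => i /andP[_ iT].
  case: ifP => _; last by case: (boolP (covers _ _ _)) => // /self ->.
  case: (boolP (dominates _ _ _)) => // /existsP[u /and3P[H1 H2 H3]].
  suff -> : [exists u : 'I_n, covers l (L u) i && ((val u == v) || adj i u v)] by [].
  apply/existsP; exists u; rewrite H3 andbT.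
  have [|_ h2 _] := pg u (ltn_ord u); last exact: h2.
  by have /andP[/appeared_end] := H1.
rewrite big1 ?add0n => [|a _]; last first.
  have out b : in_bag b v = false.
    by apply/negP => /andP[/appeared_end]; rewrite Hv.
  by rewrite /step_gain_at /vertex_gain !out.
set m := minn _ _.
rewrite (@big_cat_nat _ _ _ m 0 T) //=; last by rewrite /m; lia.
apply: leq_trans (leq_addr _ _); rewrite -{1}[m]subn0.
apply: sum_true_ge => i Hi; apply: self; rewrite /L ltn_ord Hv.
by apply: blocks_after_covers; rewrite /m in Hi; lia.
Qed.


End DynamicProgram.

(** * The dynamic program as an expression *)

Definition eN := Inp (Cst 0).
Definition eT := Inp (Cst 1).
Definition eLe a b := Sub (Cst 1) (Sub a b).
Definition eLt a b := eLe (Add a (Cst 1)) b.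
Definition eEq a b := Sub (Cst 1) (Add (Sub a b) (Sub b a)).
Definition eMin a b := Sub a (Sub a b).
Definition eAnd a b := Ite a b (Cst 0).
Definition eOr a b := Ite a (Cst 1) b.
Definition eK := eMin (Inp (Cst 2)) eT.
Definition eL := eMin (Inp (Cst 3)) eT.

Definition Call1 f a := Call f a (Cst 0) (Cst 0) (Cst 0).
Definition Call2 f a b := Call f a b (Cst 0) (Cst 0).
Definition Call3 f a b c := Call f a b c (Cst 0).

(* In [eSum d b f], the number [d] of variables in scope is the index of the   *)
(* accumulator; the index of the summation variable is [d + 1].                *)
Definition eSum d b f :=
  Fold eX (Cst 0) (Ite (eLt (Var d.+1) b) (Add (Var d) f) (Var d)).
Definition eExists d b f := eLe (Cst 1) (eSum d b f).
Definition eForall d b f := Sub (Cst 1) (eSum d b (Sub (Cst 1) f)).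

(** Repeated addition, correct when the second factor is at most the loop bound; a possibly
    exponential factor therefore comes first. *)
Definition fMul := eSum 4 (Var 1) (Var 0).
Definition eMul := Call2 fMul.

Definition fAdj :=
  eLe (Cst 1) (Inp (Add (Cst 5)
    (Add (eMul (Add (eMul (Var 0) eN) (Var 1)) eN) (Var 2)))).
Definition eAdj := Call3 fAdj.

Definition fNoniso := eExists 4 eN (eAdj (Var 0) (Var 1) (Var 5)).
Definition eNoniso := Call2 fNoniso.

Definition fAppeared :=
  eExists 4 eT (eAnd (eNoniso (Var 5) (Var 0)) (eLt (Var 5) (Var 1))).
Definition eAppeared := Call2 fAppeared.

Definition fPending :=
  eExists 4 eT (eAnd (eNoniso (Var 5) (Var 0)) (eLe (Var 1) (Add (Var 5) (Cst 1)))).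
Definition ePending := Call2 fPending.

Definition fBag := eAnd (eAppeared (Var 1) (Var 0)) (ePending (Var 1) (Var 0)).
Definition eBag := Call2 fBag.

Definition fRadix :=
  Ite (eLt (Var 1) eN)
    (Ite (eBag (Var 0) (Var 1)) (Add eK (Cst 1)) (Cst 1))
    (Ite (eBag (Var 0) (Sub (Var 1) eN)) (Add eL (Cst 2)) (Cst 1)).
Definition eRadix := Call2 fRadix.

Definition fWeight :=
  Fold eX (Cst 1)
    (Ite (eLt (Var 5) (Var 1)) (eMul (Var 4) (eRadix (Var 0) (Var 5))) (Var 4)).
Definition eWeight := Call2 fWeight.

(** The quotient is the number of positive multiples of the divisor up to the dividend; it is
    correct up to the loop bound. *)
Definition fDiv := eSum 4 eX (eLe (eMul (Var 1) (Add (Var 5) (Cst 1))) (Var 0)).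
Definition eDiv := Call2 fDiv.

Definition fReduce := Sub (Var 0) (eMul (Var 1) (eDiv (Var 0) (Var 1))).
Definition eReduce := Call2 fReduce.

(** The quotient of [j] by the wanted weight may be exponential. Reducing by all weights from the
    top down to it makes each single quotient smaller than one radix. *)
Definition fMod :=
  Fold eX (Var 1)
    (Ite (eLt (Var 5) (Sub (Add eN eN) (Var 2)))
       (eReduce (Var 4) (eWeight (Var 0) (Sub (Sub (Add eN eN) (Cst 1)) (Var 5))))
       (Var 4)).
Definition eMod := Call3 fMod.

Definition fDigit :=
  eDiv (eMod (Var 0) (Var 1) (Add (Var 2) (Cst 1))) (eWeight (Var 0) (Var 2)).
Definition eDigit := Call3 fDigit.
Definition eRem a j v := eDigit a j (Add eN v).

Definition eNext a := Add a (Cst 1).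

Definition fDominates :=
  eExists 4 eN (eAnd (eBag (eNext (Var 0)) (Var 5))
    (eAnd (eLe (Cst 1) (eRem (eNext (Var 0)) (Var 1) (Var 5)))
       (eOr (eEq (Var 5) (Var 2)) (eAdj (Var 0) (Var 5) (Var 2))))).
Definition eDominates := Call3 fDominates.

Definition fOkAt :=
  let c := eDigit (Var 0) (Var 1) (Var 3) in
  let r := eRem (Var 0) (Var 1) (Var 3) in
  let c' := eDigit (eNext (Var 0)) (Var 2) (Var 3) in
  let r' := eRem (eNext (Var 0)) (Var 2) (Var 3) in
  Ite (eBag (eNext (Var 0)) (Var 3))
    (Ite (eBag (Var 0) (Var 3))
       (eOr (eAnd (eEq c' c) (eEq r' (Sub r (Cst 1))))
            (eAnd (eEq c' (Add c (Cst 1))) (eEq r' (Add eL (Cst 1)))))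
       (eLe r' (eMul c' (Add eL (Cst 1)))))
    (Cst 1).

Definition fGainAt :=
  let c := eDigit (Var 0) (Var 1) (Var 3) in
  let r := eRem (Var 0) (Var 1) (Var 3) in
  let c' := eDigit (eNext (Var 0)) (Var 2) (Var 3) in
  let r' := eRem (eNext (Var 0)) (Var 2) (Var 3) in
  Ite (eBag (eNext (Var 0)) (Var 3))
    (Add (Ite (eBag (Var 0) (Var 3)) (Cst 0)
            (eMin (Var 0) (Sub (eMul c' (Add eL (Cst 1))) r')))
       (eDominates (Var 0) (Var 2) (Var 3)))
    (Ite (eBag (Var 0) (Var 3))
       (eMin (Sub eT (Var 0))
          (Add (Sub r (Cst 1)) (eMul (Sub eK c) (Add eL (Cst 1)))))
       (Cst 0)).

Definition fOk := eForall 4 eN (Call fOkAt (Var 0) (Var 1) (Var 2) (Var 5)).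
Definition eOk := Call3 fOk.
Definition fGain := eSum 4 eN (Call fGainAt (Var 0) (Var 1) (Var 2) (Var 5)).
Definition eGain := Call3 fGain.

Definition eWidth a := eWeight a (Add eN eN).
(** The layers are stored one after another, so state [j] of layer [a] has its cell at
    [offset a + j]. *)
Definition fOffset := eSum 4 (Var 0) (eWidth (Var 5)).
Definition eOffset := Call1 fOffset.

Definition fCandidate :=
  let b := Tab (Add (eOffset (Var 0)) (Var 1)) in
  Ite (eAnd b (eOk (Var 0) (Var 1) (Var 2)))
    (Add b (eGain (Var 0) (Var 1) (Var 2))) (Cst 0).
Definition eCandidate := Call3 fCandidate.

(** A maximum, written as [x + (y - x)] with truncated subtraction. *)
Definition fCellStep :=
  Add (Var 4) (Sub (eCandidate (Sub (Var 0) (Cst 1)) (Var 5) (Var 1)) (Var 4)).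
Definition fCell :=
  Ite (Var 0) (Fold (eWidth (Sub (Var 0) (Cst 1))) (Cst 0) fCellStep) (Cst 1).

(** The layer of a cell is the number of layers that end at or before it. *)
Definition fLayer := eSum 4 (Add eT (Cst 2)) (eLe (eOffset (eNext (Var 5))) (Var 0)).
Definition eLayer := Call1 fLayer.

Definition dp_size := eOffset (Add eT (Cst 2)).
Definition dp_cell :=
  Call2 fCell (eLayer (Var 0)) (Sub (Var 0) (eOffset (eLayer (Var 0)))).
Definition fIsolatedGain :=
  Ite (eAppeared (Var 0) eT) (Cst 0) (eMin eT (eMul eK (Add eL (Cst 1)))).
Definition fIsolated := eSum 4 eN (Call1 fIsolatedGain (Var 5)).
Definition dp_answer :=
  eLe (Inp (Cst 4))
    (Add (Sub (Tab (Sub (Var 0) (Cst 1))) (Cst 1)) (Call1 fIsolated (Cst 0))).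

(** * The expressions compute the dynamic program *)

Arguments eval : simpl never.

Section Evaluation.
Variable input : seq nat.

Let n := nth 0 input 0.
Let T := nth 0 input 1.
Let k := minn (nth 0 input 2) T.
Let l := minn (nth 0 input 3) T.
Let X := fold_bound input.

Definition input_adj (i u v : nat) : bool :=
  0 < nth 0 input (5 + ((i * n + u) * n + v)).
Let adj := input_adj.

Notation ev := (eval input).

Lemma eval_Var M env i : ev M env (Var i) = nth 0 env i. Proof. by []. Qed.
Lemma eval_Cst M env c : ev M env (Cst c) = c. Proof. by []. Qed.
Lemma eval_Add M env a b : ev M env (Add a b) = ev M env a + ev M env b.
Proof. by []. Qed.
Lemma eval_Sub M env a b : ev M env (Sub a b) = ev M env a - ev M env b.
Proof. by []. Qed.
Lemma eval_Inp M env a : ev M env (Inp a) = nth 0 input (ev M env a).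
Proof. by []. Qed.
Lemma eval_Tab M env a : ev M env (Tab a) = M (ev M env a).
Proof. by []. Qed.
Lemma eval_Ite M env a b c :
  ev M env (Ite a b c) = if 0 < ev M env a then ev M env b else ev M env c.
Proof. by rewrite /eval -/(ev M env) lt0n; case: eqP. Qed.
Lemma eval_Call M env f a b c d : ev M env (Call f a b c d) =
  ev M [:: ev M env a; ev M env b; ev M env c; ev M env d] f.
Proof. by []. Qed.
Lemma eval_Call1 M env f a : ev M env (Call1 f a) = ev M [:: ev M env a; 0; 0; 0] f.
Proof. by []. Qed.
Lemma eval_Call2 M env f a b :
  ev M env (Call2 f a b) = ev M [:: ev M env a; ev M env b; 0; 0] f.
Proof. by []. Qed.
Lemma eval_Call3 M env f a b c :
  ev M env (Call3 f a b c) = ev M [:: ev M env a; ev M env b; ev M env c; 0] f.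
Proof. by []. Qed.
Lemma eval_N M env : ev M env eN = n. Proof. by []. Qed.
Lemma eval_T M env : ev M env eT = T. Proof. by []. Qed.
Lemma eval_X M env : ev M env eX = X. Proof. by []. Qed.
Lemma eval_Le M env a b : ev M env (eLe a b) = (ev M env a <= ev M env b).
Proof. by rewrite !eval_Sub eval_Cst; case: leqP; lia. Qed.
Lemma eval_Lt M env a b : ev M env (eLt a b) = (ev M env a < ev M env b).
Proof. by rewrite eval_Le eval_Add eval_Cst addn1. Qed.
Lemma eval_Eq M env a b : ev M env (eEq a b) = (ev M env a == ev M env b).
Proof. by rewrite eval_Sub eval_Add !eval_Sub eval_Cst; case: eqP; lia. Qed.
Lemma eval_Min M env a b : ev M env (eMin a b) = minn (ev M env a) (ev M env b).
Proof. by rewrite !eval_Sub; lia. Qed.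
Lemma eval_K M env : ev M env eK = k. Proof. exact: eval_Min. Qed.
Lemma eval_L M env : ev M env eL = l. Proof. exact: eval_Min. Qed.
Lemma eval_And M env a b :
  ev M env (eAnd a b) = if 0 < ev M env a then ev M env b else 0.
Proof. exact: eval_Ite. Qed.
Lemma eval_Or M env a b :
  ev M env (eOr a b) = if 0 < ev M env a then 1 else ev M env b.
Proof. exact: eval_Ite. Qed.
Lemma eval_Next M env a : ev M env (eNext a) = (ev M env a).+1.
Proof. by rewrite eval_Add eval_Cst addn1. Qed.

Definition evE := (eval_Var, eval_Cst, eval_N, eval_T, eval_X, eval_K, eval_L,
  eval_Le, eval_Lt, eval_Eq, eval_Min, eval_And, eval_Or, eval_Next,
  eval_Add, eval_Sub, eval_Inp, eval_Tab, eval_Ite, lt0b).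

Lemma eval_Fold M env a i b : ev M env (Fold a i b) =
  iteri (ev M env a) (fun x acc => ev M (env ++ [:: acc; x]) b) (ev M env i).
Proof. by []. Qed.

Lemma eval_FoldX M env i b :
  ev M env (Fold eX i b) =
  iteri X (fun x acc => ev M (env ++ [:: acc; x]) b) (ev M env i).
Proof. by []. Qed.

Lemma iteri_inv A (Q : nat -> A -> Prop) m f x0 :
  Q 0 x0 -> (forall i x, i < m -> Q i x -> Q i.+1 (f i x)) -> Q m (iteri m f x0).
Proof.
move=> H0 HS; suff: forall i, i <= m -> Q i (iteri i f x0) by apply.
elim=> [|i IH] im //=; exact: HS (IH (ltnW im)).
Qed.

(** The loop always runs [X] rounds; the guard makes those from [B] on idle, so the invariant sums
    up to [minn i B]. *)
Lemma eval_Sum M env d b f B (F : nat -> nat) :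
  size env = d -> B <= X ->
  (forall acc x, ev M (env ++ [:: acc; x]) b = B) ->
  (forall acc x, x < B -> ev M (env ++ [:: acc; x]) f = F x) ->
  ev M env (eSum d b f) = \sum_(x < B) F x.
Proof.
move=> Hd HB Hb Hf; rewrite eval_FoldX.
rewrite -(big_mkord xpredT) -(minn_idPr HB).
apply: (iteri_inv (Q := fun i y => y = \sum_(0 <= x < minn i B) F x)).
  by rewrite min0n big_geq.
move=> i acc iX ->; rewrite !evE Hb !nth_cat Hd ltnn subnn (ltnNge d.+1) leqnSn subSnn /=.
case: ltnP => iB; last by rewrite !(minn_idPr _) //; lia.
by rewrite Hf // !(minn_idPl _) ?(ltnW iB) // big_nat_recr.
Qed.

Lemma eval_Exists M env d b f B (Q : nat -> bool) :
  size env = d -> B <= X ->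
  (forall acc x, ev M (env ++ [:: acc; x]) b = B) ->
  (forall acc x, x < B -> ev M (env ++ [:: acc; x]) f = Q x) ->
  ev M env (eExists d b f) = [exists x : 'I_B, Q x].
Proof.
move=> Hd HB Hb Hf; rewrite eval_Le eval_Cst (eval_Sum Hd HB Hb Hf).
congr nat_of_bool; rewrite lt0n sum_nat_eq0 negb_forall; apply: eq_existsb => x /=.
by case: (Q x).
Qed.

Lemma eval_Forall M env d b f B (Q : nat -> bool) :
  size env = d -> B <= X ->
  (forall acc x, ev M (env ++ [:: acc; x]) b = B) ->
  (forall acc x, x < B -> ev M (env ++ [:: acc; x]) f = Q x) ->
  ev M env (eForall d b f) = [forall x : 'I_B, Q x].
Proof.
move=> Hd HB Hb Hf; rewrite eval_Sub eval_Cst.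
rewrite (@eval_Sum M env d b _ B (fun x => ~~ Q x)) //; last first.
  by move=> acc x xB; rewrite eval_Sub eval_Cst Hf //; case: (Q x).
have -> : [forall x : 'I_B, Q x] = (\sum_(x < B) ~~ Q x == 0).
  by rewrite sum_nat_eq0; apply: eq_forallb => x /=; case: (Q x).
by case: (\sum_(_ < _) _).
Qed.

Lemma n_le_X : n <= X. Proof. by rewrite /X /fold_bound -/n; lia. Qed.
Lemma nn_le_X : n + n <= X. Proof. by rewrite /X /fold_bound -/n; lia. Qed.
Lemma T_le_X : T + 2 <= X. Proof. by rewrite /X /fold_bound -/n -/T; lia. Qed.
Lemma k_le_T : k <= T. Proof. exact: geq_minr. Qed.
Lemma l_le_T : l <= T. Proof. exact: geq_minr. Qed.

Lemma eval_Mul M env a b : ev M env b <= X ->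
  ev M env (eMul a b) = ev M env a * ev M env b.
Proof.
move=> H; rewrite eval_Call2 (@eval_Sum _ _ _ _ _ (ev M env b) (fun=> ev M env a)) //.
by rewrite sum_nat_const card_ord mulnC.
Qed.

Lemma eval_Adj M env i u v :
  ev M env (eAdj i u v) = adj (ev M env i) (ev M env u) (ev M env v).
Proof.
rewrite /adj /input_adj eval_Call3 eval_Le eval_Inp !eval_Add.
rewrite eval_Mul ?eval_N ?n_le_X // eval_Add eval_Mul ?eval_N ?n_le_X //.
Qed.

Lemma eval_Noniso M env i v :
  ev M env (eNoniso i v) = noniso n adj (ev M env i) (ev M env v).
Proof.
rewrite eval_Call2; apply: (eval_Exists (Q := fun u => adj (ev M env i) (ev M env v) u)) => //; first exact: n_le_X.
by move=> acc x _; rewrite eval_Adj.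
Qed.

Lemma eval_Appeared M env v a :
  ev M env (eAppeared v a) = appeared n T adj (ev M env v) (ev M env a).
Proof.
rewrite eval_Call2; apply: (eval_Exists (Q := fun p =>
  noniso n adj p (ev M env v) && (p < ev M env a))) => //; first by have := T_le_X; lia.
by move=> acc x _; rewrite !(eval_Noniso, evE) /=; case: (noniso _ _ _ _).
Qed.

Lemma eval_Pending M env v a :
  ev M env (ePending v a) = pending n T adj (ev M env v) (ev M env a).
Proof.
rewrite eval_Call2; apply: (eval_Exists (Q := fun q =>
  noniso n adj q (ev M env v) && (ev M env a <= q.+1))) => //; first by have := T_le_X; lia.
by move=> acc x _; rewrite !(eval_Noniso, evE) /= addn1; case: (noniso _ _ _ _).
Qed.

Lemma eval_Bag M env a v :
  ev M env (eBag a v) = in_bag n T adj (ev M env a) (ev M env v).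
Proof.
rewrite eval_Call2 !(eval_Appeared, eval_Pending, evE) /= /in_bag.
by case: (appeared _ _ _ _ _).
Qed.

Notation radix := (radix n T k l adj).
Notation width := (width n T k l adj).

Lemma eval_Radix M env a z :
  ev M env (eRadix a z) = radix (ev M env a) (ev M env z).
Proof. by rewrite eval_Call2 !(eval_Bag, evE). Qed.

Lemma radix_le_X a z : radix a z <= X.
Proof.
rewrite /radix; have := T_le_X; have := k_le_T; have := l_le_T.
by case: ifP => _; case: ifP => _; lia.
Qed.

Lemma eval_Weight M env a z : ev M env z <= n + n ->
  ev M env (eWeight a z) = weight (radix (ev M env a)) (ev M env z).
Proof.
move=> Hz; have zX := leq_trans Hz nn_le_X.
rewrite eval_Call2 eval_FoldX -[in RHS](minn_idPr zX).
apply: (iteri_inv (Q := fun i y => y = weight (radix (ev M env a)) (minn i (ev M env z)))).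
  by rewrite min0n /weight big_geq.
move=> i acc iX ->; rewrite eval_Ite eval_Lt !eval_Var /= lt0b.
case: ltnP => iz; last by rewrite !(minn_idPr _) //; lia.
rewrite eval_Mul; last by rewrite eval_Radix radix_le_X.
by rewrite eval_Radix !eval_Var /= !(minn_idPl _) ?(ltnW iz) // weightS.
Qed.

Lemma sum_ltn B m : \sum_(x < B) (x < m : nat) = minn B m.
Proof. by elim: B => [|B IH]; rewrite ?big_ord0 ?min0n // big_ord_recr /= IH; case: ltnP; lia. Qed.

Lemma eval_Div M env r w : 0 < ev M env w -> ev M env r < ev M env w * X.+1 ->
  ev M env (eDiv r w) = ev M env r %/ ev M env w.
Proof.
set rv := ev M env r; set wv := ev M env w => w0 rw.
rewrite eval_Call2 (@eval_Sum _ _ _ _ _ X (fun x => x < rv %/ wv)) //; last first.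
  move=> acc x xX; rewrite eval_Le eval_Mul; last by rewrite evE /= addn1.
  by rewrite !evE /= addn1 leq_divRL // mulnC.
have H : rv %/ wv <= X by rewrite -ltnS ltn_divLR // mulnC.
by rewrite sum_ltn (minn_idPr H).
Qed.

Lemma eval_Reduce M env r w : 0 < ev M env w -> ev M env r < ev M env w * X.+1 ->
  ev M env (eReduce r w) = ev M env r %% ev M env w.
Proof.
set rv := ev M env r; set wv := ev M env w => w0 rw.
have HD := @eval_Div M [:: rv; wv; 0; 0] (Var 0) (Var 1) w0 rw.
rewrite eval_Call2 eval_Sub eval_Mul HD !eval_Var /=.
  by rewrite -/rv -/wv {1}(divn_eq rv wv) mulnC addKn.
by rewrite -ltnS ltn_divLR // mulnC.
Qed.

Lemma eval_Mod M env a j z : ev M env z <= n + n -> ev M env j < width (ev M env a) ->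
  ev M env (eMod a j z) = ev M env j %% weight (radix (ev M env a)) (ev M env z).
Proof.
set av := ev M env a; set jv := ev M env j; set zv := ev M env z => Hz Hj.
have pos y : 0 < weight (radix av) y by apply/weight_gt0/radix_gt0.
rewrite eval_Call3 eval_FoldX.
have Ez : n + n - minn X (n + n - zv) = zv by have := nn_le_X; lia.
rewrite -[in RHS]Ez.
apply: (iteri_inv (Q := fun i y => y = jv %% weight (radix av) (n + n - minn i (n + n - zv)))).
  by rewrite min0n subn0 modn_small.
move=> i acc iX ->; rewrite eval_Ite eval_Lt !evE /=.
case: ltnP => iz; last by rewrite !(minn_idPr _) //; lia.
set y := n + n - 1 - i.
have E1 : n + n - i = y.+1 by rewrite /y; lia.
have E2 : n + n - minn i.+1 (n + n - zv) = y by rewrite /y; lia.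
rewrite E1 E2.
set env' := [:: av; _; _; _; _; _].
have HW : ev M env' (eWeight (Var 0) (Sub (Sub (Add eN eN) (Cst 1)) (Var 5))) = weight (radix av) y.
  by rewrite eval_Weight !evE //= /y; lia.
rewrite eval_Reduce HW // !evE /=; last first.
  apply: (@leq_trans (weight (radix av) y.+1)); first by rewrite ltn_mod.
  by rewrite weightS leq_mul2l (leq_trans (radix_le_X _ _)) ?orbT.
by rewrite modn_dvdm // weight_dvd.
Qed.

Lemma eval_Digit M env a j z : ev M env z < n + n -> ev M env j < width (ev M env a) ->
  ev M env (eDigit a j z) = digit (radix (ev M env a)) (ev M env j) (ev M env z).
Proof.
set av := ev M env a; set jv := ev M env j; set zv := ev M env z => Hz Hj.
have pos y : 0 < weight (radix av) y by apply/weight_gt0/radix_gt0.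
rewrite eval_Call3; set env' := [:: av; jv; zv; 0].
have HW : ev M env' (eWeight (Var 0) (Var 2)) = weight (radix av) zv.
  by rewrite eval_Weight !evE //= ltnW.
have HM : ev M env' (eMod (Var 0) (Var 1) (Add (Var 2) (Cst 1))) = jv %% weight (radix av) zv.+1.
  by rewrite eval_Mod !evE /= ?addn1.
rewrite eval_Div HW ?HM //.
apply: (@leq_trans (weight (radix av) zv.+1)); first by rewrite ltn_mod.
by rewrite weightS leq_mul2l (leq_trans (radix_le_X _ _)) ?orbT.
Qed.

Lemma eval_Count M env a j v : ev M env v < n -> ev M env j < width (ev M env a) ->
  ev M env (eDigit a j v) = st_count n T k l adj (ev M env a) (ev M env j) (ev M env v).
Proof. by move=> H1 H2; rewrite eval_Digit //; lia. Qed.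

Lemma eval_Rem M env a j v : ev M env v < n -> ev M env j < width (ev M env a) ->
  ev M env (eRem a j v) = st_rem n T k l adj (ev M env a) (ev M env j) (ev M env v).
Proof. by move=> H1 H2; rewrite eval_Digit ?eval_Add ?eval_N //; lia. Qed.

Lemma eval_Dominates M env a j v :
  ev M env v < n -> ev M env j < width (ev M env a).+1 ->
  ev M env (eDominates a j v) =
  dominates n T k l adj (ev M env a) (ev M env j) (ev M env v).
Proof.
move=> Hv Hj; rewrite eval_Call3; apply: (eval_Exists (Q := fun u =>
  [&& in_bag n T adj (ev M env a).+1 u,
      0 < st_rem n T k l adj (ev M env a).+1 (ev M env j) u
    & (u == ev M env v) || adj (ev M env a) u (ev M env v)])) => //; first exact: n_le_X.
move=> acc x xn; rewrite !(eval_Bag, eval_Adj, evE) eval_Rem !evE //=.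
by case: (in_bag _ _ _ _ _); case: (0 < st_rem _ _ _ _ _ _ _ _); case: (x == _).
Qed.

Lemma eval_OkAt M a j j' v : v < n -> j < width a -> j' < width a.+1 ->
  ev M [:: a; j; j'; v] fOkAt = step_ok_at n T k l adj a j j' v.
Proof.
move=> Hv Hj Hj'; rewrite /fOkAt /step_ok_at /vertex_ok.
have lX : l + 1 <= X by have := T_le_X; have := l_le_T; lia.
rewrite !(eval_L, eval_Next, eval_Or, eval_And, eval_Eq, eval_Le, eval_Ite, eval_Bag, eval_Sub).
rewrite eval_Mul ?eval_Add ?eval_L // !eval_Rem ?eval_Next //.
rewrite !eval_Count ?eval_Next // !evE /= !addn1.
case: (in_bag n T adj a.+1 v) => //; case: (in_bag n T adj a v) => //.
by do !case: (_ == _).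
Qed.

Lemma eval_GainAt M a j j' v : v < n -> j < width a -> j' < width a.+1 ->
  ev M [:: a; j; j'; v] fGainAt = step_gain_at n T k l adj a j j' v.
Proof.
move=> Hv Hj Hj'; rewrite /fGainAt /step_gain_at /vertex_gain.
have lX : l + 1 <= X by have := T_le_X; have := l_le_T; lia.
rewrite !(eval_K, eval_L, eval_Next, eval_Ite, eval_Bag, eval_Min, eval_Sub, eval_Add).
rewrite !eval_Mul ?eval_Add ?eval_L // eval_Dominates ?eval_Next // !eval_Rem ?eval_Next //.
by rewrite !eval_Count ?eval_Next // !evE eval_Count // !addn1.
Qed.

Lemma eval_Ok M env a j j' :
  ev M env j < width (ev M env a) -> ev M env j' < width (ev M env a).+1 ->
  ev M env (eOk a j j') = step_ok n T k l adj (ev M env a) (ev M env j) (ev M env j').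
Proof.
move=> Hj Hj'; rewrite eval_Call3; apply: (eval_Forall (Q := fun v =>
  step_ok_at n T k l adj (ev M env a) (ev M env j) (ev M env j') v)) => //; first exact: n_le_X.
by move=> acc x xn; rewrite eval_Call eval_OkAt.
Qed.

Lemma eval_Gain M env a j j' :
  ev M env j < width (ev M env a) -> ev M env j' < width (ev M env a).+1 ->
  ev M env (eGain a j j') = step_gain n T k l adj (ev M env a) (ev M env j) (ev M env j').
Proof.
move=> Hj Hj'; rewrite eval_Call3; apply: (eval_Sum (F := fun v =>
  step_gain_at n T k l adj (ev M env a) (ev M env j) (ev M env j') v)) => //; first exact: n_le_X.
by move=> acc x xn; rewrite eval_Call eval_GainAt.
Qed.

Lemma eval_Width M env a : ev M env (eWidth a) = width (ev M env a).
Proof. by rewrite eval_Weight !evE. Qed.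

Definition offset (a : nat) : nat := \sum_(b < a) width b.

Lemma eval_Offset M env a : ev M env a <= T + 2 ->
  ev M env (eOffset a) = offset (ev M env a).
Proof.
move=> Ha; rewrite eval_Call1; apply: (eval_Sum (F := fun b => width b)) => //; first exact: leq_trans Ha T_le_X.
by move=> acc x _; rewrite eval_Width.
Qed.

Lemma offsetS a : offset a.+1 = offset a + width a.
Proof. by rewrite /offset big_ord_recr. Qed.

Lemma offset_mono a b : a <= b -> offset a <= offset b.
Proof.
move=> ab; rewrite -(subnKC ab); elim: (b - a) => [|d IH]; first by rewrite addn0.
by rewrite addnS offsetS (leq_trans IH) // leq_addr.
Qed.

Lemma eval_Layer M env e a j :
  a < T + 2 -> j < width a -> ev M env e = offset a + j -> ev M env (eLayer e) = a.
Proof.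
move=> aT jw E; rewrite eval_Call1 E.
rewrite (@eval_Sum _ _ _ _ _ (T + 2) (fun x => x < a)) //; first last.
- move=> acc x xT; rewrite eval_Le eval_Offset !evE /=; last by lia.
  congr nat_of_bool; case: (ltnP x a) => xa.
    by apply: leq_trans (offset_mono xa) (leq_addr _ _).
  by apply/negbTE; rewrite -ltnNge (leq_trans _ (@offset_mono a.+1 x.+1 _)) // offsetS ltn_add2l.
- exact: T_le_X.
by rewrite sum_ltn; lia.
Qed.

Notation best := (best n T k l adj).

Lemma eval_dp_cell M a j : a < T + 2 -> j < width a ->
  (forall b i, b < a -> i < width b -> M (offset b + i) = best b i) ->
  ev M [:: offset a + j] dp_cell = best a j.
Proof.
move=> aT jw HM; rewrite eval_Call2.
have EL : ev M [:: offset a + j] (eLayer (Var 0)) = a by exact: (@eval_Layer _ _ _ a j).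
rewrite eval_Sub eval_Offset EL; last by lia.
rewrite eval_Var /= addKn eval_Ite eval_Var /=.
case: a aT jw HM {EL} => [|a] aT jw HM //=.
rewrite eval_Fold eval_Width eval_Sub eval_Var eval_Cst /= subn1 /=.
rewrite -(big_mkord xpredT (fun i => if (best a i != 0) && step_ok n T k l adj a i j
  then best a i + step_gain n T k l adj a i j else 0)).
apply: (iteri_inv (Q := fun i y => y = \max_(0 <= x < i)
  (if (best a x != 0) && step_ok n T k l adj a x j
  then best a x + step_gain n T k l adj a x j else 0))).
  by rewrite big_geq.
move=> i acc iw ->; rewrite big_nat_recr //=.
rewrite eval_Add eval_Sub eval_Call3 eval_Sub !eval_Var eval_Cst /= subn1 /=.
have -> : forall x y, maxn x y = x + (y - x) by lia.
congr (_ + (_ - _)).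
rewrite /fCandidate eval_Ite eval_And eval_Add eval_Tab eval_Add eval_Offset; last by rewrite eval_Var /=; lia.
rewrite eval_Ok ?evE // eval_Gain ?evE //= HM // !lt0n.
by case: (best a i == 0); case: (step_ok _ _ _ _ _ _ _ _).
Qed.

Lemma eval_dp_size M env : ev M env dp_size = offset (T + 2).
Proof. by rewrite eval_Offset !evE. Qed.

(** A cell only refers to the preceding layer, all of whose cells have smaller addresses. *)
Lemma table_best m a j : m <= offset (T + 2) -> a < T + 2 -> j < width a ->
  offset a + j < m -> table dp_cell input m (offset a + j) = best a j.
Proof.
elim: m a j => [|m IH] a j // Hm aT jw; rewrite ltnS leq_eqVlt /=.
case: (offset a + j =P m) => [E _|E /= H]; last first.
  by rewrite upd_other ?IH //; [lia | apply/eqP].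
rewrite -E upd_same; apply: eval_dp_cell => // b i ba iw; rewrite E; apply: IH => //.
- by lia.
- by lia.
- rewrite -E (leq_trans _ (leq_addr _ _)) // (leq_trans _ (offset_mono ba)) //.
  by rewrite offsetS ltn_add2l.
Qed.

Lemma eval_dp_answer :
  ev (table dp_cell input (offset (T + 2))) [:: offset (T + 2)] dp_answer =
  (nth 0 input 4 <= optimum n T k l adj).
Proof.
(* The last cell of the table is the only cell of layer [T + 1]. *)
have E : offset (T + 2) - 1 = offset T.+1 + 0.
  by rewrite addn2 offsetS width_last addnK addn0.
rewrite eval_Le eval_Add eval_Sub eval_Tab eval_Sub eval_Var /= !eval_Cst E.
rewrite table_best //; first last.
- by rewrite -E -subn_gt0 subKn // addn2 offsetS width_last; lia.
- by rewrite width_last.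
- by lia.
rewrite eval_Inp eval_Cst /optimum; congr (nat_of_bool (_ <= _ + _)).
rewrite eval_Call1; apply: (eval_Sum (F := fun v => isolated_gain n T k l adj v)) => //; first exact: n_le_X.
move=> acc x xn; rewrite eval_Call1 eval_Ite eval_Appeared !evE /= /isolated_gain.
case: ifP => // _; rewrite eval_Mul !evE //.
by have := T_le_X; have := l_le_T; lia.
Qed.

End Evaluation.

(** * Timelines and the optimum of the dynamic program *)

Section Timelines.
Variables (n T : nat) (G : tgraph 'I_n T) (k0 l0 t : nat).
Variable adjn : nat -> nat -> nat -> bool.
Hypothesis adjnE : forall (i : 'I_T) (u v : 'I_n), adjn i u v = adj G i u v.

Let k := minn k0 T.
Let l := minn l0 T.

Lemma adjn_sym i u v : i < T -> u < n -> v < n -> adjn i u v = adjn i v u.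
Proof.
move=> iT un vn; have := adjnE (Ordinal iT) (Ordinal un) (Ordinal vn) => /= ->.
by rewrite adj_sym -adjnE.
Qed.

(** The witness [i'] lets times be plain numbers, as in the dynamic program. *)
Lemma card_dominated A :
  #|dominated G A| = \sum_(v < n) \sum_(0 <= i < T)
     [exists u : 'I_n, [exists i' : 'I_T, (val i' == i) && active A u i'
        && ((val u == v) || adjn i u v)]].
Proof.
under eq_bigr do rewrite big_mkord.
rewrite -sum1_card big_mkcond pair_bigA /=; apply: eq_bigr => -[v i] _ /=.
rewrite inE /=; set b := [exists _, _]; set c := [exists _, _].
suff -> : b = c by case: c.
apply/existsP/existsP => -[u].
  rewrite !inE => /andP[H1 H2]; exists u; apply/existsP; exists i.
  by rewrite eqxx H1 adjnE /= -[val u == val v]/(u == v) eq_sym.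
move=> /existsP[i' /andP[/andP[/eqP/val_inj -> H1] H2]]; exists u.
by rewrite H1 /= !inE (eq_sym v) -val_eqE /= -adjnE.
Qed.

Lemma timeline_le_optimum A :
  is_timeline k0 l0 A -> #|dominated G A| <= optimum n T k l adjn.
Proof.
move=> /andP[/forall_inP HA /forallP Hk].
(* Only starting times are kept. Intervals of one vertex with equal start count once, which bounds
   the starts by [T] as well as by [k0]. *)
pose S v i := [exists I in A, (val (vertex_of I) == v) && (val (first_of I) == i)].
have [|H _] := @dp_complete n T k l adjn adjn_sym S.
  move=> v vn; rewrite big_mkord leq_min; apply/andP; split; last first.
    rewrite -[X in _ <= X]card_ord -sum1_card; apply: leq_sum => i _.
    by case: (S v i).
  apply: leq_trans (Hk (Ordinal vn)).
  apply: leq_trans (leq_imset_card (@first_of _ _) _).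
  rewrite -sum1_card [X in _ <= X]big_mkcond; apply: leq_sum => i _.
  case: (boolP (S v i)) => // /exists_inP[I IA /andP[/eqP H1 /eqP H2]].
  suff -> : i \in [set first_of x | x in [set I in A | vertex_of I == Ordinal vn]] by [].
  by apply/imsetP; exists I; [rewrite inE IA -val_eqE /= H1 eqxx | apply: val_inj].
apply: leq_trans H; rewrite card_dominated; apply: leq_sum => v _.
rewrite !big_mkord; apply: leq_sum => i _.
case: (boolP [exists u, _]) => // /existsP[u /existsP[i' /andP[/andP[/eqP Ei Hu] Huv]]].
rewrite lt0b; apply/existsP; exists u; rewrite Huv andbT.
have [I IA /andP[/eqP H1 /andP[H2 H3]]] := exists_inP Hu.
have /andP[H4 H5] := HA I IA.
apply: (@remaining_cover l _ (first_of I)).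
  by apply/exists_inP; exists I => //; rewrite H1 !eqxx.
by move: (ltn_ord i') H2 H3 H5; rewrite -Ei /l /=; lia.
Qed.

Lemma optimum_timeline :
  exists2 A, is_timeline k0 l0 A & optimum n T k l adjn <= #|dominated G A|.
Proof.
have [L [HL Hopt]] := @dp_sound n T k l adjn adjn_sym.
(* Intervals are clipped at the last time. The end is a function of the start, so a vertex has no
   more intervals than starts. *)
pose A : {set activity 'I_n T} :=
  [set I : activity 'I_n T | (val (first_of I) \in L (vertex_of I)) &&
           (val (last_of I) == minn (first_of I + l) T.-1)].
have lastT (i : 'I_T) : minn (i + l) T.-1 < T by have := ltn_ord i; lia.
exists A.
  apply/andP; split.
    apply/forall_inP => I; rewrite inE => /andP[_ /eqP /= ->].
    by have := ltn_ord (first_of I); rewrite /l; lia.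
  apply/forallP => v; apply: (@leq_trans (size (L v))); last first.
    by apply: leq_trans (HL v) _; apply: geq_minl.
  rewrite cardE -(size_map (fun I => val (first_of I))); apply: uniq_leq_size.
    rewrite map_inj_in_uniq ?enum_uniq // => -[[v1 a1] b1] [[v2 a2] b2].
    rewrite !mem_enum !inE /=.
    move=> /andP[/andP[_ /eqP E1] /eqP V1] /andP[/andP[_ /eqP E2] /eqP V2] E.
    congr (_, _, _); first by rewrite [v1]V1 [v2]V2.
      exact: val_inj.
    by apply: val_inj; rewrite /= [val b1]E1 [val b2]E2 /= [val a1]E.
  move=> s /mapP[I]; rewrite mem_enum !inE => /andP[/andP[H _] /eqP V] ->.
  by rewrite -V.
apply: leq_trans Hopt _; rewrite card_dominated; apply: leq_sum => v _.
rewrite !big_mkord; apply: leq_sum => i _.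
case: (boolP [exists u : 'I_n, covers _ _ _ && _]) => // /existsP[u /andP[Hc Huv]].
rewrite lt0b; apply/existsP; exists u; apply/existsP; exists i.
rewrite Huv eqxx andbT /=.
have /hasP[s sL /andP[si il]] := Hc.
have sT : s < T by apply: leq_ltn_trans si (ltn_ord i).
apply/exists_inP; exists (u, Ordinal sT, Ordinal (lastT (Ordinal sT))).
  by rewrite inE /= sL eqxx.
by rewrite /= eqxx si /=; have := ltn_ord i; lia.
Qed.

Lemma timeline_optimum :
  timeline_partial_dominating_set G k0 l0 t = (t <= optimum n T k l adjn).
Proof.
apply/existsP/idP => [[A /andP[HA Ht]]|Ht].
  exact: leq_trans Ht (timeline_le_optimum HA).
by have [A HA H] := optimum_timeline; exists A; rewrite HA (leq_trans Ht).
Qed.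

(** Digits of vertices outside the bag have radix 1, and each bag vertex contributes one factor
    [(k + 1) * (l + 2)], which truncation only lowers. *)
Lemma width_le a : width n T k l adjn a <= ((k0 + 1) * (l0 + 2)) ^ vimw G.
Proof.
have B0 : 0 < (k0 + 1) * (l0 + 2) by rewrite muln_gt0 !addn_gt0 !orbT.
pose F := [set v : 'I_n | in_bag n T adjn a v].
have cardF : #|F| <= vimw G.
  case: (posnP #|F|) => [-> //|/card_gt0P[v0]]; rewrite inE => /andP[H1 H2].
  have a0 : 0 < a by case: (a) H1 => // /existsP[p]; rewrite andbF.
  have aT : a.-1 < T.
    by have /existsP[q /andP[_ H]] := H2; have := ltn_ord q; lia.
  apply: leq_trans (leq_bigmax (Ordinal aT)); apply: subset_leq_card.
  have nz (p : 'I_T) (v : 'I_n) : noniso n adjn p v -> 0 < deg G p v.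
    move=> /existsP[u]; rewrite adjnE => Hu; apply/card_gt0P; exists u.
    by rewrite inE.
  apply/subsetP => v; rewrite !inE => /andP[/existsP[p /andP[Hp pa]] /existsP[q /andP[Hq qa]]].
  apply/existsP; exists p; apply/existsP; exists q.
  by rewrite !nz //= !andbT; lia.
apply: leq_trans (leq_pexp2l B0 cardF).
have -> : width n T k l adjn a = \prod_(v < n)
    ((if in_bag n T adjn a v then k + 1 else 1) * (if in_bag n T adjn a v then l + 2 else 1)).
  rewrite big_split /= /width /weight big_mkord big_split_ord /=.
  congr (_ * _); apply: eq_bigr => v _; rewrite /radix /= ?ltn_ord //.
  by rewrite ltnNge leq_addr /= addKn.
rewrite -prod_nat_const [X in _ <= X]big_mkcond; apply: leq_prod => v _.
rewrite inE; case: ifP => // _; apply: leq_mul; rewrite leq_add2r; exact: geq_minl.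
Qed.

End Timelines.

(** * Reading the adjacency matrices from the encoding *)

Lemma nth_flatten_uniform m (s : seq (seq nat)) i j :
  all (fun r => size r == m) s -> i < size s -> j < m ->
  nth 0 (flatten s) (i * m + j) = nth 0 (nth [::] s i) j.
Proof.
elim: s i => [|r s IH] [|i] //= /andP[/eqP Hr Hs] Hi Hj.
  by rewrite nth_cat mul0n add0n Hr Hj.
by rewrite nth_cat Hr mulSn -addnA ltnNge leq_addr /= addKn IH.
Qed.

Lemma size_flatten_uniform m (s : seq (seq nat)) :
  all (fun r => size r == m) s -> size (flatten s) = size s * m.
Proof. by elim: s => [|r s IH] //= /andP[/eqP Hr Hs]; rewrite size_cat Hr IH ?mulSn. Qed.

Lemma input_adj_encode n T (G : tgraph 'I_n T) k l t (i : 'I_T) (u v : 'I_n) :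
  input_adj (encode G k l t) i u v = adj G i u v.
Proof.
rewrite /input_adj /encode /=; set s := flatten _.
have -> : (i * n + u) * n + v = i * (n * n) + (u * n + v) by nia.
pose row (i : 'I_T) (u : 'I_n) := [seq nat_of_bool (adj G i u v) | v <- enum 'I_n].
pose mx (i : 'I_T) := [seq row i u | u <- enum 'I_n].
have Hrow i' : all (fun r => size r == n) (mx i').
  by apply/allP => r /mapP[u' _ ->]; rewrite size_map size_enum_ord.
have Hmx : all (fun r => size r == n * n) [seq flatten (mx i) | i <- enum 'I_T].
  apply/allP => r /mapP[i' _ ->].
  by rewrite (size_flatten_uniform (Hrow i')) size_map size_enum_ord.
have uv : u * n + v < n * n by have := ltn_ord u; have := ltn_ord v; nia.
rewrite (nth_flatten_uniform Hmx) 1?size_map ?size_enum_ord //.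
rewrite (nth_map i) ?size_enum_ord // nth_ord_enum.
rewrite (nth_flatten_uniform (Hrow i)) 1?size_map ?size_enum_ord //.
rewrite (nth_map u) ?size_enum_ord // nth_ord_enum.
by rewrite (nth_map v) ?size_enum_ord // nth_ord_enum lt0b.
Qed.

Lemma poly_fCellStep : poly fCellStep.
Proof. by repeat constructor. Qed.

Lemma poly_dp_size : poly dp_size.
Proof. by repeat constructor. Qed.

Lemma poly_dp_answer : poly dp_answer.
Proof. by repeat constructor. Qed.

Lemma poly_Layer : poly (eLayer (Var 0)).
Proof. by repeat constructor. Qed.

Lemma poly_Offset : poly (Sub (Var 0) (eOffset (eLayer (Var 0)))).
Proof. by repeat constructor. Qed.

Lemma poly_Width : poly (eWidth (Sub (Var 0) (Cst 1))).
Proof. by repeat constructor. Qed.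

(** * Running time *)

Definition input_width (input : seq nat) : nat -> nat :=
  let T := nth 0 input 1 in
  width (nth 0 input 0) T (minn (nth 0 input 2) T) (minn (nth 0 input 3) T)
    (input_adj input).

(** [dp_cell] is not [poly] because of the loop over the previous layer; its other parts and the
    body of that loop are, and the loop brings the factor [W]. *)
Lemma cost_dp_cell : exists c, forall input M env W,
  (forall a, input_width input a <= W) -> 0 < W ->
  cost input M env dp_cell <= W * fold_bound input ^ c.
Proof.
have [c1 H1] := poly_cost poly_Layer.
have [c2 H2] := poly_cost poly_Offset.
have [c3 H3] := poly_cost poly_Width.
have [c4 H4] := poly_cost poly_fCellStep.
eexists=> input M env W HW W0.
set X := fold_bound input; have X2 := fold_bound_gt1 input; have Xc := leq_expn_self input.
set s := X ^ c1 + X ^ c2 + X ^ c3 + X ^ c4 + 20.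
apply: (@leq_trans (W * s)); last first.
  by rewrite leq_mul2l; apply/orP; right; rewrite /s; do 4![apply: leq_expn_add => //].
have cell : forall a j, cost input M [:: a; j; 0; 0] fCell <= X ^ c3 + W * (X ^ c4 + 6) + 8.
  move=> a j.
  have -> : cost input M [:: a; j; 0; 0] fCell =
    1 + if eval input M [:: a; j; 0; 0] (Var 0) == 0 then 1 + 1
        else cost input M [:: a; j; 0; 0]
               (Fold (eWidth (Sub (Var 0) (Cst 1))) (Cst 0) fCellStep) + 2 by [].
  case: ifP => _; first by lia.
  have -> : forall e i b, cost input M [:: a; j; 0; 0] (Fold e i b) =
    cost input M [:: a; j; 0; 0] e + cost input M [:: a; j; 0; 0] i +
    \sum_(x < eval input M [:: a; j; 0; 0] e)
       (cost input M ([:: a; j; 0; 0] ++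
          [:: fold_acc input M [:: a; j; 0; 0] i b x; val x]) b + 6) + 4 by [].
  have := H3 input M [:: a; j; 0; 0].
  suff : \sum_(x < eval input M [:: a; j; 0; 0] (eWidth (Sub (Var 0) (Cst 1))))
     (cost input M ([:: a; j; 0; 0] ++
          [:: fold_acc input M [:: a; j; 0; 0] (Cst 0) fCellStep x; val x]) fCellStep + 6)
     <= W * (X ^ c4 + 6).
    rewrite -/X; set u := \sum_(x < _) _; set v := cost _ _ _ (eWidth _).
    by rewrite -[cost input M _ (Cst 0)]/1; lia.
  apply: (@leq_trans (\sum_(x < eval input M [:: a; j; 0; 0] (eWidth (Sub (Var 0) (Cst 1)))) (X ^ c4 + 6))).
    by apply: leq_sum => x _; rewrite leq_add2r.
  by rewrite sum_nat_const card_ord leq_mul2r eval_Width HW orbT.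
have -> : cost input M env dp_cell =
  cost input M env (eLayer (Var 0)) +
  cost input M env (Sub (Var 0) (eOffset (eLayer (Var 0)))) + 1 + 1 +
  cost input M [:: eval input M env (eLayer (Var 0));
    eval input M env (Sub (Var 0) (eOffset (eLayer (Var 0)))); 0; 0] fCell + 1 by [].
have := H1 input M env; have := H2 input M env.
have := cell (eval input M env (eLayer (Var 0)))
  (eval input M env (Sub (Var 0) (eOffset (eLayer (Var 0))))).
rewrite -/X /s => h1 h2 h3.
apply: (@leq_trans (X ^ c1 + X ^ c2 + 1 + 1 + (X ^ c3 + W * (X ^ c4 + 6) + 8) + 1)); first by lia.
rewrite !mulnDr.
have m1 y : y <= W * y by rewrite leq_pmull.
by have := m1 (X ^ c1); have := m1 (X ^ c2); have := m1 (X ^ c3); lia.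
Qed.

(** One factor [W] comes from the number of cells, at most [X * W], the other from the time for each
    cell. *)
Lemma dp_time : exists c, forall input W,
  (forall a, input_width input a <= W) -> 0 < W ->
  table_time dp_size dp_cell dp_answer input <= W ^ 2 * fold_bound input ^ c.
Proof.
have [c1 H1] := poly_cost poly_dp_size.
have [c2 H2] := poly_cost poly_dp_answer.
have [c3 H3] := cost_dp_cell.
eexists=> input W HW W0.
set X := fold_bound input; have X2 := fold_bound_gt1 input; have Xc := leq_expn_self input.
rewrite /table_time; set N := eval _ _ _ dp_size.
have HN : N <= X * W.
  rewrite /N eval_dp_size /offset.
  apply: (@leq_trans (\sum_(b < nth 0 input 1 + 2) W)).
    by apply: leq_sum => b _; apply: HW.
  by rewrite sum_nat_const card_ord leq_mul2r; have := T_le_X input; rewrite -/X => ->; rewrite orbT.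
have HC : \sum_(m < N) (cost input (table dp_cell input m) [:: val m] dp_cell + 8) <=
    W ^ 2 * (X * (X ^ c3 + 8)).
  apply: (@leq_trans (\sum_(m < N) (W * (X ^ c3 + 8)))).
    apply: leq_sum => m _; rewrite mulnDr leq_add ?H3 //.
    by rewrite leq_pmull.
  rewrite sum_nat_const card_ord; apply: (@leq_trans (X * W * (W * (X ^ c3 + 8)))).
    by rewrite leq_mul2r HN orbT.
  by rewrite -mulnn (mulnC X W) -!mulnA (mulnCA X W).
apply: (@leq_trans (W ^ 2 * (X ^ c1 + X * (X ^ c3 + 8) + X ^ c2 + 4))).
  have W2 : 0 < W ^ 2 by rewrite expn_gt0 W0.
  rewrite !mulnDr.
  have m1 y : y <= W ^ 2 * y by rewrite leq_pmull.
  have := H1 input (fun=> 0) [::]; have := H2 input (table dp_cell input N) [:: N].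
  have := m1 (X ^ c1); have := m1 (X ^ c2); have := m1 4.
  by rewrite -/X; move: HC; rewrite !mulnDr; lia.
rewrite leq_mul2l orbC; apply/orP; left.
apply: leq_expn_add => //; apply: leq_expn_add => //; apply: leq_expn_add => //.
apply: (@leq_trans (X * X ^ (c3 + 8).+1)); last by rewrite -expnS.
by rewrite leq_mul2l leq_expn_add ?orbT.
Qed.

(* (n + T)^{O(1)} is rendered by a fixed exponent c; the base is max(2, n + T) *)
(* so that the factor is not 0 or 1, whatever c, when n + T <= 1.              *)
Theorem theorem4p3 :
  exists (P : program) (c : nat),
    forall (n T : nat) (G : tgraph 'I_n T) (k l t : nat),
      1 <= k ->
      decides_within P (encode G k l t)
        (timeline_partial_dominating_set G k l t)
        (((k + 1) * (l + 2)) ^ (2 * vimw G) * (maxn 2 (n + T)) ^ c).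
Proof.
have [c Hc] := dp_time.
(* With [Y = maxn 2 (n + T)] the loop bound [n + n + (T + 2)] is at most [3 * Y], hence at most
   [Y ^ 3]. *)
exists (table_program dp_size dp_cell dp_answer), (3 * c) => n T G k l t _.
have [m [H1 H2 H3]] := table_programP dp_size dp_cell dp_answer (encode G k l t).
exists m; split=> //; last first.
  rewrite H3 eval_dp_size eval_dp_answer.
  congr nat_of_bool; apply/esym.
  exact: (@timeline_optimum n T G k l t _ (@input_adj_encode n T G k l t)).
apply: leq_trans H1 _; set B := (k + 1) * (l + 2).
have B0 : 0 < B by rewrite muln_gt0 !addn_gt0 !orbT.
apply: leq_trans (Hc _ (B ^ vimw G) _ _) _.
- move=> a; exact: (@width_le n T G k l _ (@input_adj_encode n T G k l t)).
- by rewrite expn_gt0 B0.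
rewrite (mulnC 2) expnM; apply: leq_mul => //; rewrite expnM.
case: c {Hc} => [|c] //; rewrite leq_exp2r //.
rewrite /fold_bound /= !expnS expn0 muln1.
set Y := maxn 2 (n + T); have Y2 : 2 <= Y by rewrite leq_maxl.
have YT : n + T <= Y by rewrite leq_maxr.
by apply: (@leq_trans (2 * Y + Y)); [lia | nia].
Qed.
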